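(* Let $H\le F_n$ be a finitely generated subgroup, let $g\in F_n$, $g\neq1$, be an element that depends on $H$, and let $d\ge1$ be an integer. Let $G=\mathrm{core}_*(H)\vee\mathrm{core}_*(\langle g\rangle)$, with labeling map $f:G\to R_n$, and let $L$ be the number of edges of $G$. Let $w\in\mathfrak I_g$ be a (non-trivial) cyclically reduced equation of degree $d$ and let $\sigma:I_l\to G$ be the corresponding reduced path. Then there is a cyclically reduced equation $w'\in\mathfrak I_g$ of degree $d$ with corresponding path $\sigma':I_{l'}\to G$, and a maximal reduction process for $f\circ\sigma'$, such that: (i) The path $\sigma'$ has length $l'\le 32L^4d^2+16L^3d$. (ii) The path $\sigma$ can be obtained from $\sigma'$ by means of at most $l'/2$ parallel insertion moves, each of them performed on a distinct couple of edges of $I_{l'}$ (belonging to that reduction process).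
   Context: Equations. $F_n$ is the free group with basis $a_1,\dots,a_n$, $\overline u=u^{-1}$, and $\langle x\rangle\cong\mathbb Z$. An equation is an element $w\in H*\langle x\rangle$, uniquely expressed as a reduced word in the alphabet $\{x,x^{-1}\}\cup(H\setminus\{1\})$; its degree is the number of occurrences of $x$ and $x^{-1}$ in its cyclic reduction. $w$ is a cyclically reduced equation if, written as a reduced word in the letters $a_1,\dots,a_n,x$ and their inverses, the word is cyclically reduced. $\varphi_g:H*\langle x\rangle\to F_n$ is the inclusion on $H$ and sends $x$ to $g$; $\mathfrak I_g=\ker\varphi_g$. $g$ depends on $H$ if $\mathfrak I_g\neq1$. Graphs and paths. A graph is a 1-dimensional CW complex (loops and multiple edges allowed). A combinatorial map of graphs is a continuous map sending vertices to vertices and each open edge homeomorphically onto an open edge. $I_l$ ($l\ge1$) is the unit interval subdivided into $l$ edges; $C_l$ is the circle subdivided into $l$ edges. A combinatorial path (loop) is a combinatorial map from some $I_l$ (some $C_l$); it is reduced if it is locally injective. For an edge $s$ of $I_l$, $o^-(s)<o^+(s)$ are its endpoints. Core graphs. $R_n$ is the rose with one vertex and $n$ oriented edges labeled $a_1,\dots,a_n$, with $\pi_1(R_n,* )=F_n$. For $1\ne K\le F_n$, $(\mathrm{cov}(K),* )\to(R_n,* )$ is the pointed covering with fundamental group $K$; $\mathrm{core}(K)$ is the union of the images of all reduced loops in $\mathrm{cov}(K)$, and $\mathrm{core}_*(K)$ is the union of the images of all reduced paths in $\mathrm{cov}(K)$ from $*$ to itself. They are labeled by restricting the covering map. $G$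 is obtained from $\mathrm{core}_*(H)\sqcup\mathrm{core}_*(\langle g\rangle)$ by identifying the basepoints to a point $*$; $f:G\to R_n$ is the labeling map. $\theta:H*\langle x\rangle\to\pi_1(G,* )$ is the isomorphism sending each element of $H$ to the corresponding class in $\mathrm{core}_*(H)$ and $x$ to the class in $\mathrm{core}_*(\langle g\rangle)$ corresponding to $g$. The path corresponding to a non-trivial equation $w$ is the unique reduced path $\sigma:I_l\to G$ with $\sigma(0)=\sigma(1)=*$ in the class $\theta(w)$. Reduction processes. A reduction process for a combinatorial path $\tau$ with domain $I_l$ is a sequence $(s_1,t_1),\dots,(s_m,t_m)$ such that: $s_1,t_1,\dots,s_m,t_m$ are pairwise distinct edges of $I_l$; $o^-(s_k)<o^-(t_k)$ for all $k$; for every $k$, after collapsing each of $s_1,t_1,\dots,s_{k-1},t_{k-1}$ to a point, $s_k$ and $t_k$ are adjacent; and $\tau$ sends $s_k,t_k$ to the same edge crossed with opposite orientations. It is maximal if it cannot be extended by adding one further couple $(s_{m+1},t_{m+1})$. If $\tau$ is a closed path homotopically trivial relative to endpoints, maximal processes have exactly $l/2$ couples. Insertion moves. Let $\sigma:I_l\to G$ be reduced with $\sigma(0)=\sigma(1)=*$ and $f\circ\sigma$ homotopically trivial rel endpoints, with a maximal reduction process for $f\circ\sigma$ containing the couple $(s_\alpha,t_\alpha)$, where $\sigma(s_\alpha),\sigma(t_\alpha)$ belong to $\mathrm{core}(H)$. For a vertex $v$ of $\mathrm{core}(H)$, $\pi_1(\mathrm{core}(H),v)$ is regarded as a subgroup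 of $F_n$ via the labeling. An insertion word for $\sigma$ at $(s_\alpha,t_\alpha)$ is an element $u\in F_n$ that (i) lies in $\pi_1(\mathrm{core}(H),\sigma(o^-(s_\alpha)))\cap\pi_1(\mathrm{core}(H),\sigma(o^+(t_\alpha)))$; (ii) begins (as a reduced word) with the label of $\sigma(s_\alpha)$ if $\sigma$ crosses that edge with the orientation of the labeling, and with the inverse of that label otherwise; (iii) is cyclically reduced. Let $r$ be the length of $u$, $\tau_1:I_r\to G$ the reduced path representing $u$ in $\pi_1(\mathrm{core}(H),\sigma(o^-(s_\alpha)))$ and $\tau_2:I_r\to G$ the reduced path representing $\overline u$ in $\pi_1(\mathrm{core}(H),\sigma(o^+(t_\alpha)))$. The parallel insertion move relative to $u,(s_\alpha,t_\alpha)$ cuts $I_l$ at $o^-(s_\alpha)$ and $o^+(t_\alpha)$, inserts an interval of length $r$ at each cut, and produces the path $I_{l+2r}\to G$ equal to $\sigma$ on the old edges, to $\tau_1$ on the interval inserted at $o^-(s_\alpha)$ and to $\tau_2$ on the interval inserted at $o^+(t_\alpha)$. The new path $\rho$ is again reduced and closed at $*$, with $f\circ\rho$ homotopically trivial, and $f\circ\rho$ has a maximal reduction process containing all the couples of the old one; when several insertion moves are performed successively, such processes are used, and the edges of the original interval are identified with the corresponding edges of the enlarged intervals. *)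

(* Defs.v *)
From HB Require Import structures.
From mathcomp Require Import all_boot.
From mathcomp Require Import finmap boolp classical_sets cardinality.

Set Implicit Arguments.
Unset Strict Implicit.
Unset Printing Implicit Defensive.

Local Open Scope classical_set_scope.

(* The group F_n is represented by the reduced words in its letters:
   [(a, true)] is the letter [a], [(a, false)] its inverse. The same type
   represents the oriented edges of a graph with edge set [T]. *)
Notation letter T := (T * bool)%type.

Section Words.
Variable T : eqType.
Implicit Types (x y : letter T) (p q : seq (letter T)).

Definition flip x : letter T := (x.1, ~~ x.2).

Definition invw p := rev (map flip p).

Definition noback : rel (letter T) := fun x y => y != flip x.

Definition reduced p := sorted noback p.

Definition cyc_reduced p := cycle noback p.

Definition push x p :=
  if p is y :: p' then if y == flip x then p' else x :: p else [:: x].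

Definition reduce p := foldr push [::] p.

Lemma flipK : involutive flip.
Proof. by case=> a b; rewrite /flip /= negbK. Qed.

Lemma noback_sym x y : noback (flip y) (flip x) = noback x y.
Proof.
by rewrite /noback flipK; congr negb; apply/eqP/eqP => [<- | ->]; rewrite ?flipK.
Qed.

Lemma reduced_push x p : reduced p -> reduced (push x p).
Proof.
rewrite /reduced; case: p => [|y p] //= red_p.
case: ifP => [_|/negbT ne]; first exact: path_sorted red_p.
by rewrite /= red_p andbT.
Qed.

Lemma reduced_foldr p q : reduced q -> reduced (foldr push q p).
Proof. by move=> red_q; elim: p => //= x p; apply: reduced_push. Qed.

Lemma reduced_reduce p : reduced (reduce p).
Proof. exact: reduced_foldr. Qed.

Lemma reduce_id p : reduced p -> reduce p = p.
Proof.
rewrite /reduce; elim: p => [|x p IH] //= red_p.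
rewrite (IH (path_sorted red_p)); case: p {IH} red_p => [|y p] //= /andP[xy _].
by rewrite ifN.
Qed.

Lemma push_flipK x p : reduced p -> push x (push (flip x) p) = p.
Proof.
case: p => [|y p] /=; first by rewrite eqxx.
rewrite flipK; case: (eqVneq y x) => [->|_] /=; last by rewrite eqxx.
by case: p => [|z p] //= /andP[xz _]; rewrite ifN.
Qed.

Lemma foldr_push x p q : reduced q ->
  foldr push q (push x p) = push x (foldr push q p).
Proof.
move=> red_q; case: p => [|y p] //=; case: eqP => [->|_] //=.
by rewrite push_flipK // reduced_foldr.
Qed.

Lemma foldr_reduce p q : reduced q -> foldr push q (reduce p) = foldr push q p.
Proof. by move=> red_q; elim: p => //= x p IH; rewrite foldr_push // IH. Qed.

Lemma reduce_cat p q : reduce (p ++ q) = foldr push (reduce q) p.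
Proof. by rewrite /reduce foldr_cat. Qed.

Lemma reduce_catl p q : reduce (reduce p ++ q) = reduce (p ++ q).
Proof. by rewrite !reduce_cat foldr_reduce // reduced_reduce. Qed.

Lemma reduce_catr p q : reduce (p ++ reduce q) = reduce (p ++ q).
Proof. by rewrite !reduce_cat reduce_id // reduced_reduce. Qed.

Lemma invwK : involutive invw.
Proof. by move=> p; rewrite /invw map_rev revK mapK //; apply: flipK. Qed.

Lemma reduced_invw p : reduced (invw p) = reduced p.
Proof.
rewrite /reduced /invw rev_sorted sorted_map; apply: eq_sorted => x y /=.
exact: noback_sym.
Qed.

Lemma reduce_catV p : reduce (p ++ invw p) = [::].
Proof.
elim: p => [|x p IH] //=.
rewrite /invw /= rev_cons -cats1 catA -/(invw p) /reduce /= -/(reduce _).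
by rewrite -reduce_catl IH /= eqxx.
Qed.

Lemma reduce_catVl p : reduce (invw p ++ p) = [::].
Proof. by rewrite -{2}(invwK p) reduce_catV. Qed.

End Words.

Record freegrp (T : eqType) := FreeGrp
  {fgword :> seq (letter T); fgwordP : reduced fgword}.

HB.instance Definition _ (T : eqType) := [isSub for @fgword T].
HB.instance Definition _ (T : eqType) := [Equality of freegrp T by <:].
HB.instance Definition _ (T : choiceType) := [Choice of freegrp T by <:].

Section FreeGroup.
Variable T : choiceType.
Implicit Types u v w : freegrp T.

Definition fg_one : freegrp T := FreeGrp (isT : reduced [::]).
Definition fg_mul u v : freegrp T := FreeGrp (reduced_reduce (u ++ v)).
Definition fg_inv u : freegrp T :=
  FreeGrp (etrans (reduced_invw u) (fgwordP u)).

Lemma fg_mulA : associative fg_mul.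
Proof.
by move=> u v w; apply: val_inj; rewrite /= reduce_catl reduce_catr catA.
Qed.

Lemma fg_mul1 : left_id fg_one fg_mul.
Proof. by move=> u; apply: val_inj; rewrite /= reduce_id // fgwordP. Qed.

Lemma fg_1mul : right_id fg_one fg_mul.
Proof. by move=> u; apply: val_inj; rewrite /= cats0 reduce_id // fgwordP. Qed.

Lemma fg_mulV : left_inverse fg_one fg_inv fg_mul.
Proof. by move=> u; apply: val_inj; rewrite /= reduce_catVl. Qed.

Lemma fg_Vmul : right_inverse fg_one fg_inv fg_mul.
Proof. by move=> u; apply: val_inj; rewrite /= reduce_catV. Qed.

HB.instance Definition _ :=
  isGroup.Build (freegrp T) fg_mulA fg_mul1 fg_1mul fg_mulV fg_Vmul.

Definition fg_gen (a : T) : freegrp T := FreeGrp (isT : reduced [:: (a, true)]).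

End FreeGroup.

Local Open Scope group_scope.

Definition is_subgroup (A : groupType) (K : set A) := group_closed [in K].

Definition generated (A : groupType) (S : set A) : set A :=
  smallest (@is_subgroup A) S.

Definition finitely_generated (A : groupType) (K : set A) :=
  exists S : seq A, K = generated [set` S].

(* The letters of the alphabet {x, x^-1} u F_n : [inl true] is x, [inl false]
   is x^-1, [inr h] is the coefficient h. An element of H * <x> is represented
   by its unique expression as a reduced word in {x, x^-1} u (H \ {1}). *)
Notation syllable n := (bool + freegrp 'I_n)%type.

Section Equations.
Variable n : nat.
Implicit Types (s t : syllable n) (w : seq (syllable n)).

Definition syl_adj : rel (syllable n) := fun s t =>
  match s, t with
  | inl b, inl b' => b' != ~~ b
  | inr _, inr _ => false
  | _, _ => true
  end.

Definition is_equation (H : set (freegrp 'I_n)) w :=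
  sorted syl_adj w /\ forall h, inr h \in w -> H h /\ h <> 1.

Definition phi (g : freegrp 'I_n) w : freegrp 'I_n :=
  \prod_(s <- w)
    match s with inl b => if b then g else g^-1 | inr h => h end.

Definition eq_ideal (H : set (freegrp 'I_n)) (g : freegrp 'I_n) :
    set (seq (syllable n)) :=
  [set w | is_equation H w /\ phi g w = 1].

Definition depends_on (g : freegrp 'I_n) (H : set (freegrp 'I_n)) :=
  exists2 w, eq_ideal H g w & w <> [::].

(* Cyclic reduction in the free product: while the word has at least two
   letters, cancel x^e ... x^-e at the two ends, and bring a first coefficient
   h next to the last coefficient k; [m] bounds the number of steps. *)
Fixpoint cyc_reduction_rec (m : nat) w :=
  match m, w with
  | m'.+1, s :: t0 :: w0 =>
      let mid := belast t0 w0 in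
      match s, last t0 w0 with
      | inl b, inl b' => if b' == ~~ b then cyc_reduction_rec m' mid else w
      | inr h, inr k =>
          if k * h == 1 then cyc_reduction_rec m' mid
          else rcons mid (inr (k * h))
      | _, _ => w
      end
  | _, _ => w
  end.

Definition cyc_reduction w := cyc_reduction_rec (size w) w.

Definition degree w := count (fun s => if s is inl _ then true else false)
                             (cyc_reduction w).

(* The expression of an equation in the letters a_1, ..., a_n, x (here [None])
   and their inverses. It is reduced, because no two coefficients are
   adjacent. *)
Definition eq_word w : seq (letter (option 'I_n)) :=
  flatten [seq match s with
               | inl b => [:: (None, b)]
               | inr h => [seq (Some a.1, a.2) | a <- fgword h]
               end | s <- w].

Definition cyc_reduced_equation w := cyc_reduced (eq_word w).

End Equations.

(* A pointed 1-dimensional CW complex with an orientation of each edge and a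
   labeling of the edges, i.e. a combinatorial map to the rose R_n. *)
Record lgraph (n : nat) := LGraph {
  vertex : choiceType;
  edge : choiceType;
  src : edge -> vertex;
  tgt : edge -> vertex;
  lab : edge -> 'I_n;
  base : vertex
}.

(* A combinatorial path is the sequence of the oriented edges it crosses:
   [(e, true)] when [e] is crossed with its orientation, [(e, false)]
   otherwise. The i-th edge of the domain I_l is represented by its index
   i < l. *)
Notation dart X := (letter (edge X)).
Notation gpath X := (seq (letter (edge X))).

Section Graphs.
Variables (n : nat) (X : lgraph n).
Implicit Types (v w : vertex X) (d : dart X) (p q : gpath X).

Definition dsrc d : vertex X := if d.2 then src d.1 else tgt d.1.
Definition dtgt d : vertex X := if d.2 then tgt d.1 else src d.1.

Fixpoint walk v p w : bool :=
  if p is d :: p' then (dsrc d == v) && walk (dtgt d) p' w else v == w.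

Definition dlab d : letter 'I_n := (lab d.1, d.2).

Definition labeling p : seq (letter 'I_n) := map dlab p.

Definition crosses p (e : edge X) := e \in [seq d.1 | d <- p].

(* Homotopy relative to the endpoints [v] and [w]: the equivalence relation on
   combinatorial paths generated by the removal of backtracks. *)
Inductive homotopic v w : gpath X -> gpath X -> Prop :=
| homotopic_refl p : walk v p w -> homotopic v w p p
| homotopic_sym p q : homotopic v w p q -> homotopic v w q p
| homotopic_trans p q r :
    homotopic v w p q -> homotopic v w q r -> homotopic v w p r
| homotopic_cancel p d q : walk v (p ++ d :: flip d :: q) w ->
    homotopic v w (p ++ d :: flip d :: q) (p ++ q).

Definition nb_edges : nat := #|` fset_set [set: edge X] |.

End Graphs.

Definition rose (n : nat) : lgraph n :=
  @LGraph n unit 'I_n (fun=> tt) (fun=> tt) id tt.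

Definition null_homotopic n (tau : seq (letter 'I_n)) :=
  homotopic (X := rose n) tt tt tau [::].

Section Span.
Variables (n : nat) (X : lgraph n) (E : set (edge X)).

Definition in_span (v : vertex X) : bool :=
  `[< v = base X \/ exists2 e, E e & src e = v \/ tgt e = v >].

Definition span_vertex := {v : vertex X | in_span v}.
Definition span_edge := {e : edge X | e \in E}.

Lemma in_span_src (e : span_edge) : in_span (src (val e)).
Proof.
by apply/asboolP; right; exists (val e); [exact/set_mem/(valP e) | left].
Qed.

Lemma in_span_tgt (e : span_edge) : in_span (tgt (val e)).
Proof.
by apply/asboolP; right; exists (val e); [exact/set_mem/(valP e) | right].
Qed.

Lemma in_span_base : in_span (base X).
Proof. by apply/asboolP; left. Qed.

Definition span : lgraph n :=
  @LGraph n span_vertex span_edge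
    (fun e => Sub _ (in_span_src e)) (fun e => Sub _ (in_span_tgt e))
    (fun e => lab (val e)) (Sub _ in_span_base).

End Span.

(* The wedge of two pointed graphs: the basepoint of [Y] is removed from the
   vertices and replaced by the basepoint of [X]. *)
Section Wedge.
Variables (n : nat) (X Y : lgraph n).

Definition wedge_vertex := (vertex X + {v : vertex Y | v != base Y})%type.

Definition wedge_inr (v : vertex Y) : wedge_vertex :=
  if insub v is Some v' then inr v' else inl (base X).

Definition wedge : lgraph n :=
  @LGraph n wedge_vertex (edge X + edge Y)%type
    (fun e => match e with inl e => inl (src e) | inr e => wedge_inr (src e) end)
    (fun e => match e with inl e => inl (tgt e) | inr e => wedge_inr (tgt e) end)
    (fun e => match e with inl e => lab e | inr e => lab e end)
    (inl (base X)).

End Wedge.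

(* The pointed covering of R_n with fundamental group K is the Schreier graph
   of the right cosets of K: an edge labeled a_i goes from Ku to K u a_i, so
   that the paths from K to K are those whose label represents an element
   of K. *)
Section Covering.
Variables (n : nat) (K : set (freegrp 'I_n)).

Definition rcos (u : freegrp 'I_n) : set (freegrp 'I_n) :=
  [set k * u | k in K].

Definition is_rcos (A : set (freegrp 'I_n)) : bool :=
  `[< exists u, A = rcos u >].

Definition cov_vertex := {A : {eclassic set (freegrp 'I_n)} | is_rcos A}.

Definition translate (a : freegrp 'I_n) (A : set (freegrp 'I_n)) :
  set (freegrp 'I_n) := [set v * a | v in A].

Lemma is_rcos_base : is_rcos (rcos 1).
Proof. by apply/asboolP; exists 1. Qed.

Lemma is_rcos_translate a A : is_rcos A -> is_rcos (translate a A).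
Proof.
move=> /asboolP[u ->]; apply/asboolP; exists (u * a).
by rewrite /translate /rcos image_comp; apply: eq_imagel => k _ /=; rewrite mulgA.
Qed.

Definition cov : lgraph n :=
  @LGraph n cov_vertex (cov_vertex * 'I_n)%type
    fst
    (fun e => Sub _ (is_rcos_translate (fg_gen e.2) (valP e.1)))
    snd
    (Sub _ is_rcos_base).

(* A combinatorial loop C_l -> cov(K) is a closed path up to rotation; it is
   reduced when it has no backtrack, including between its last and first
   edges. The graph core(K) is determined by its edges. *)
Definition core_edges : set (edge cov) :=
  [set e | exists v p, [/\ walk v p v, cyc_reduced p & crosses p e]].

(* Only meaningful for K <> 1, as core_*(K) is; then the basepoint, which [span]
   adds to the vertices, is an endpoint of one of these edges. *)
Definition core_star_edges : set (edge cov) :=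
  [set e | exists p, [/\ walk (base cov) p (base cov), reduced p & crosses p e]].

Definition core_star : lgraph n := span core_star_edges.

End Covering.

Notation couple := (nat * nat)%type.

Definition entries (P : seq couple) : seq nat :=
  flatten [seq [:: c.1; c.2] | c <- P].

Section Reduction.
Variables (n : nat) (tau : seq (letter 'I_n)).

(* After collapsing the edges of the first k couples, two remaining edges s < t
   are adjacent iff every edge strictly between them has been collapsed. *)
Definition reduction_process (P : seq couple) :=
  [/\ uniq (entries P),
      forall c, c \in P -> c.1 < c.2 < size tau,
      forall k i, k < size P ->
        (nth (0, 0) P k).1 < i < (nth (0, 0) P k).2 -> i \in entries (take k P)
    & forall c, c \in P -> onth tau c.2 = omap (@flip _) (onth tau c.1)].

Definition maximal_process (P : seq couple) :=
  reduction_process P /\ forall c, ~ reduction_process (rcons P c).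

End Reduction.

Section Insertions.
Variables (n : nat) (H : set (freegrp 'I_n)) (g : freegrp 'I_n).

Definition wedge_graph : lgraph n :=
  wedge (core_star H) (core_star (generated [set g])).

Local Notation G := wedge_graph.
Implicit Types (p rho : gpath G) (v : vertex G) (u : freegrp 'I_n).

Definition in_left (e : edge G) : bool := if e is inl _ then true else false.

(* core_*(H) -> R_n is an immersion inducing an isomorphism of pi_1 onto H, so
   the class corresponding to [h] contains a unique reduced path, and this is
   the closed path whose label is the reduced word [h]; likewise for <g>. *)
Definition syllable_loop (s : syllable n) p :=
  walk (base G) p (base G) /\
  match s with
  | inr h => all (fun d => in_left d.1) p /\ labeling p = fgword h
  | inl b => all (fun d => ~~ in_left d.1) p /\
             labeling p = fgword (if b then g else g^-1)
  end.

(* [p] is the concatenation of the closed paths corresponding to the letters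
   of [w]; its homotopy class is theta(w). *)
Fixpoint theta_path (w : seq (syllable n)) p :=
  if w is s :: w' then
    exists p1 p2, [/\ p = p1 ++ p2, syllable_loop s p1 & theta_path w' p2]
  else p = [::].

Definition corresponding_path (w : seq (syllable n)) p :=
  [/\ walk (base G) p (base G), reduced p &
      exists2 q, theta_path w q & homotopic (base G) (base G) q p].

Definition in_core (e : edge G) : Prop :=
  if e is inl e' then core_edges (val e') else False.

(* [p] is the reduced closed path representing [u] in pi_1(core(H), v). It is
   reduced because its label is. *)
Definition core_loop v u p :=
  [/\ walk v p v, forall d, d \in p -> in_core d.1 & labeling p = fgword u].

Definition pi1_core v : set (freegrp 'I_n) := [set u | exists p, core_loop v u p].

Definition admissible rho :=
  [/\ walk (base G) rho (base G), reduced rho & null_homotopic (labeling rho)].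

Definition insertion_word (ds dt : dart G) u :=
  [/\ pi1_core (dsrc ds) u, pi1_core (dtgt dt) u,
      ohead (fgword u) = Some (dlab ds) & cyc_reduced (fgword u)].

Definition parallel_insertion rho (c : couple) u rho' :=
  exists ds dt tau1 tau2,
    [/\ onth rho c.1 = Some ds, onth rho c.2 = Some dt,
        in_core ds.1 & in_core dt.1] /\
    [/\ insertion_word ds dt u,
        core_loop (dsrc ds) u tau1,
        core_loop (dtgt dt) u^-1 tau2
      & rho' = take c.1 rho ++ tau1 ++ drop c.1 (take c.2.+1 rho)
               ++ tau2 ++ drop c.2.+1 rho].

(* The index, after an insertion of intervals of length [r] at the couple [c],
   of the edge that had index [i]. *)
Definition shift (c : couple) (r i : nat) : nat :=
  if i < c.1 then i else if i <= c.2 then i + r else i + r.*2.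

Definition shift_couple c r (c' : couple) : couple :=
  (shift c r c'.1, shift c r c'.2).

(* [insertions rho P cs rho']: starting from [rho] with the maximal process
   [P], insertion moves performed successively on the couples of [cs] lead
   to [rho']. The couples of [cs] are couples of edges of the domain of [rho];
   after a move, the remaining ones are identified with couples of edges of
   the enlarged interval, whose process contains the couples of the old one. *)
Inductive insertions : gpath G -> seq couple -> seq couple -> gpath G -> Prop :=
| insertions_nil rho P : insertions rho P [::] rho
| insertions_cons rho P c cs u rho1 P1 rho2 :
    admissible rho -> maximal_process (labeling rho) P -> c \in P ->
    parallel_insertion rho c u rho1 ->
    maximal_process (labeling rho1) P1 ->
    (forall c', c' \in P -> shift_couple c (size (fgword u)) c' \in P1) ->
    insertions rho1 P1 [seq shift_couple c (size (fgword u)) c' | c' <- cs] rho2 ->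
    insertions rho P (c :: cs) rho2.

End Insertions.

(* Main.v *)
(* Since [f o sigma] is trivial, a maximal reduction process pairs all the edges of
   [sigma], and the couples form a planar forest of arcs. Call a couple plain when
   both its edges lie in core(H), and colour it by the two darts that [sigma] crosses
   there. If a plain couple [(s, t)] has the same colour as a plain couple [(s', t')]
   inside it, and all the couples between them are parallel plain ones, then the edges
   from [s] to [s'] and from [t'] to [t] can be removed, and this is undone by a
   parallel insertion move at [(s', t')]. Keeping, from the outside to the inside, the
   last couple of each colour, every remaining couple is used for at most one insertion
   and each family of parallel plain couples has at most [2L^2] members.

   No plain couple is innermost, because labelings of core graphs are locally
   injective; hence the number of families is at most twice the number [Q] of couples
   that are not plain, and the length is at most [2Q(1 + 4L^2)]. Finally [Q <= 4Ld]: a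
   dart outside core(H) is crossed at most once by each reduced loop of core_*(H), the
   loop of [g] crosses no dart twice, and [w] has [d] letters [x^(+-1)] and at most
   [d + 1] coefficients. *)

Require Import Defs.
From HB Require Import structures.
From mathcomp Require Import all_boot.
From mathcomp Require Import finmap boolp classical_sets cardinality.
From mathcomp Require Import zify.

Set Implicit Arguments.
Unset Strict Implicit.
Unset Printing Implicit Defensive.

Local Open Scope classical_set_scope.
Local Open Scope group_scope.

(** * Cutting a sequence at a repeated element *)

Lemma sorted_cat_consE (S : Type) (e : rel S) (A B : seq S) x :
  sorted e (A ++ x :: B) = sorted e (rcons A x) && path e x B.
Proof. by case: A => [|a A] //=; rewrite cat_path rcons_path /= andbA. Qed.

(** Gluing the two occurrences of [x] creates no new adjacency: what precedes [x] preceded the first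
    one, and what follows it followed the second. *)
Lemma sorted_cut (S : Type) (e : rel S) (A m B : seq S) x :
  sorted e (A ++ x :: m ++ x :: B) -> sorted e (A ++ x :: B).
Proof.
rewrite !sorted_cat_consE cat_path /= => /andP[-> /andP[_ /andP[_ ->]]] //.
Qed.

Lemma sorted_cut_loop (S : Type) (e : rel S) (A m B : seq S) x :
  sorted e (A ++ x :: m ++ x :: B) -> cycle e (x :: m).
Proof.
by rewrite sorted_cat_consE cat_path /= rcons_path => /andP[_ /andP[-> /andP[->]]].
Qed.

(** * Reduced words *)

Section ReducedWords.
Variable T : eqType.
Implicit Types (x y : letter T) (p q : seq (letter T)).

Lemma reduced_catl p q : reduced (p ++ q) -> reduced p.
Proof. by move=> /cat_sorted2[]. Qed.

Lemma reduced_catr p q : reduced (p ++ q) -> reduced q.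
Proof. by move=> /cat_sorted2[]. Qed.

Definition starts_in (S : pred T) p := if p is x :: _ then S x.1 else false.

(** The letters at the junction cannot cancel, one being over [S] and the other not. This serves for
    the two sides of the wedge and for coefficients next to letters [x]. *)
Lemma reduced_cat_sides (S : pred T) p q : reduced p -> reduced q ->
  all (fun x => S x.1) p -> ~~ starts_in S q -> reduced (p ++ q).
Proof.
case: q => [|y q]; first by rewrite cats0.
elim: p => [//|x p IH] red_p red_q /= /andP[Sx Sp] Sy.
have := IH (path_sorted red_p) red_q Sp Sy.
case: p red_p {IH Sp} => [|z p] /=; last by move=> /andP[-> _].
by move=> _ ->; rewrite andbT; apply: contraNneq Sy => ->.
Qed.

Lemma reduce_subseq p : subseq (reduce p) p.
Proof.
rewrite /reduce; elim: p => //= x p IH; case E: (foldr _ _ _) IH => [|y q] IH /=.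
  by rewrite eqxx sub0seq.
case: ifP => [_|_]; last by rewrite eqxx.
apply: subseq_trans (subseq_trans _ IH) (subseq_cons _ _).
exact: subseq_cons.
Qed.

Lemma reduce_idem p : reduce (reduce p) = reduce p.
Proof. by rewrite reduce_id // reduced_reduce. Qed.

Lemma reduce_cancel A p B : reduce (A ++ invw p ++ p ++ B) = reduce (A ++ B).
Proof.
by rewrite -reduce_catr (catA (invw p)) -(reduce_catl (_ ++ p)) reduce_catVl
  !reduce_catr.
Qed.

Lemma flip_neq x : flip x != x.
Proof. by case: x => a b; rewrite /flip xpair_eqE eqxx /=; case: b. Qed.

Lemma invw_cons x p : invw (x :: p) = rcons (invw p) (flip x).
Proof. by rewrite /invw /= rev_cons. Qed.

Lemma invw_rcons p x : invw (rcons p x) = flip x :: invw p.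
Proof. by rewrite /invw map_rcons rev_rcons. Qed.

Lemma size_invw p : size (invw p) = size p.
Proof. by rewrite /invw size_rev size_map. Qed.

Lemma cyc_reducedE x0 p : p != [::] ->
  cyc_reduced p = reduced p && noback (last x0 p) (head x0 p).
Proof. by case: p => //= x p _; rewrite /cyc_reduced /= rcons_path. Qed.

(* The cyclically reduced part [c] survives in the powers of [t c t^-1]. *)
Lemma reduced_conj p : reduced p -> p != [::] ->
  exists t c, [/\ p = t ++ c ++ invw t, cyc_reduced c & c != [::]].
Proof.
have [k] := ubnP (size p); elim: k p => // k IH [//|x p] sz red_p _.
have [cyc|] := boolP (cyc_reduced (x :: p)).
  by exists [::], (x :: p); rewrite /invw /= cats0.
rewrite (cyc_reducedE x) // red_p /= negbK => /eqP.
case/lastP: p sz red_p => [|p y] sz red_p.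
  by move=> /= /esym/eqP; rewrite (negPf (flip_neq x)).
rewrite last_rcons => /(congr1 (@flip T)); rewrite flipK => yE; subst y.
have red_p' : reduced p.
  by move: red_p; rewrite /reduced -cat1s -cats1 => /reduced_catr/reduced_catl.
have p0 : p != [::].
  by apply: contraTneq red_p => ->; rewrite /reduced /= /noback eqxx.
rewrite /= size_rcons !ltnS in sz.
have [t [c [pE cyc c0]]] := IH p (ltnW sz) red_p' p0.
exists (x :: t), c; split=> //.
by rewrite invw_cons pE -!cats1 /= !catA.
Qed.

Fixpoint wpow k p := if k is k'.+1 then p ++ wpow k' p else [::].

(** Each new junction inside the power joins the end of [c] to its beginning, which cyclic
    reducedness allows; the junctions with [t] are those of the first power. *)
Lemma reduced_wpow c t k : cyc_reduced c -> c != [::] ->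
  reduced (t ++ c ++ invw t) -> reduced (t ++ wpow k.+1 c ++ invw t).
Proof.
case: c => // x c cyc _ red1; elim: k => [|k IH]; first by rewrite /= cats0.
have cE : forall k, wpow k.+1 (x :: c) = x :: c ++ wpow k (x :: c) by [].
rewrite !cE cat_cons -catA /reduced sorted_cat_consE cat_path.
move: IH; rewrite cE cat_cons -catA /reduced sorted_cat_consE => /andP[-> /=].
move=> ->; move: cyc.
by rewrite /cyc_reduced /= rcons_path => /andP[-> ->].
Qed.

Lemma size_wpow k p : size (wpow k p) = (k * size p)%N.
Proof. by elim: k => //= k IH; rewrite size_cat IH mulSn. Qed.

Lemma reduce_wpow_conj t c k :
  reduce (wpow k.+1 (t ++ c ++ invw t)) = reduce (t ++ wpow k.+1 c ++ invw t).
Proof.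
elim: k => [|k IH]; first by rewrite /= !cats0.
have -> : forall p, wpow k.+2 p = p ++ wpow k.+1 p by [].
by rewrite -reduce_catr IH reduce_catr -!catA (catA t) reduce_cancel -!catA.
Qed.

(** Write [p] as [t c t^-1]: its power reduces to [t c^(k+1) t^-1], where nothing more cancels. *)
Lemma size_reduce_wpow p k : reduced p -> size p <= size (reduce (wpow k.+1 p)).
Proof.
move=> red_p; have [->//|p0] := eqVneq p [::].
have [t [c [pE cyc c0]]] := reduced_conj red_p p0.
rewrite pE reduce_wpow_conj reduce_id; last first.
  by apply: reduced_wpow; rewrite -?pE.
by rewrite !size_cat size_wpow leq_add2l leq_add2r leq_addr.
Qed.

End ReducedWords.

(** * Paths and homotopy *)

Section Walks.
Variables (n : nat) (X : lgraph n).
Implicit Types (v w u : vertex X) (d : dart X) (p q : gpath X).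

Lemma dsrc_flip d : dsrc (flip d) = dtgt d.
Proof. by case: d => e []. Qed.

Lemma dtgt_flip d : dtgt (flip d) = dsrc d.
Proof. by case: d => e []. Qed.

Lemma dlab_flip d : dlab (flip d) = flip (dlab d).
Proof. by []. Qed.

Lemma labeling_cat p q : labeling (p ++ q) = labeling p ++ labeling q.
Proof. exact: map_cat. Qed.

Lemma labeling_invw p : labeling (invw p) = invw (labeling p).
Proof. by rewrite /labeling /invw map_rev -!map_comp. Qed.

Lemma walk_catP v p q w :
  reflect (exists2 u, walk v p u & walk u q w) (walk v (p ++ q) w).
Proof.
apply: (iffP idP) => [|[u]].
  elim: p v => [|d p IH] v /=; first by exists v.
  by case/andP=> vd /IH[u pu qu]; exists u; rewrite ?vd.
elim: p v => [|d p IH] v /=; first by move=> /eqP->.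
by case/andP=> -> pu qu /=; apply: IH.
Qed.

Lemma walk_invw v p w : walk v p w -> walk w (invw p) v.
Proof.
elim: p v => [|d p IH] v /=; first by rewrite eq_sym.
case/andP=> /eqP vd /IH pw; rewrite invw_cons -cats1.
apply/walk_catP; exists (dtgt d) => //=.
by rewrite dsrc_flip dtgt_flip vd !eqxx.
Qed.

Lemma walk_cut v A s m B w :
  walk v (A ++ s :: m ++ s :: B) w -> walk v (A ++ s :: B) w.
Proof.
case/walk_catP=> u Au /= /andP[/eqP us /walk_catP[u' _ /= /andP[_ sB]]].
by apply/walk_catP; exists u => //=; rewrite us eqxx.
Qed.

Lemma walk_cut_loop v A s m B w :
  walk v (A ++ s :: m ++ s :: B) w -> walk (dsrc s) (s :: m) (dsrc s).
Proof.
case/walk_catP=> u Au /= /andP[_ /walk_catP[u' su' /= /andP[/eqP-> _]]].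
by rewrite eqxx.
Qed.

Lemma walk_push v d p w : walk v (d :: p) w -> walk v (push d p) w.
Proof.
case: p => [|y p] //=; case: (y =P flip d) => [->|_ //].
by rewrite dtgt_flip => /andP[/eqP <- /andP[_]].
Qed.

Lemma walk_reduce v p w : walk v p w -> walk v (reduce p) w.
Proof.
elim: p v => [|d p IH] v //= /andP[vd pw].
by apply: (walk_push (d := d)); rewrite /= vd; apply: IH.
Qed.

(** Together with [homotopic_reducer], this makes [reduce] a normal form for homotopy relative to
    endpoints. *)
Lemma homotopic_reduce v w p q : homotopic v w p q -> reduce p = reduce q.
Proof.
elim=> {p q} [p _|p q _|p q r _ -> _|p d q _] //.
by rewrite -reduce_catr [reduce [:: _, _ & _]]/= -/(reduce q) push_flipK
  ?reduced_reduce // reduce_catr.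
Qed.

Lemma homotopic_cons v w d p q : dsrc d == v ->
  homotopic (dtgt d) w p q -> homotopic v w (d :: p) (d :: q).
Proof.
move=> vd; elim=> {p q} [p pw|p q _|p q r _ pq _|p e q peq].
- by apply: homotopic_refl; rewrite /= vd.
- exact: homotopic_sym.
- exact: homotopic_trans.
by apply: (@homotopic_cancel _ _ _ _ (d :: p)); rewrite /= vd.
Qed.

Lemma homotopic_reducer v w p : walk v p w -> homotopic v w p (reduce p).
Proof.
elim: p v => [|d p IH] v pw; first exact: homotopic_refl.
have /= /andP[vd pw'] := pw.
apply: homotopic_trans (homotopic_cons vd (IH _ pw')) _.
have : walk v (d :: reduce p) w by rewrite /= vd walk_reduce.
rewrite -/(reduce p); case: (reduce p) => [|y q] /= dq; first exact: homotopic_refl.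
case: (y =P flip d) dq => [->|_] dq; first exact: (@homotopic_cancel _ _ _ _ [::]).
exact: homotopic_refl.
Qed.

Lemma reduced_of_labeling p : reduced (labeling p) -> reduced p.
Proof.
rewrite /reduced /labeling sorted_map; apply: sub_sorted => x y.
by apply: contra => /eqP->; rewrite dlab_flip eqxx.
Qed.

(** A backtrack of the path is sent to a cancelling pair of letters, so removing it in the graph
    does not change the element of the free group. *)
Lemma reduce_labeling p : reduce (labeling (reduce p)) = reduce (labeling p).
Proof.
elim: p => //= d p IH; rewrite -/(reduce p) -/(reduce (labeling p)) -IH.
have := reduced_reduce p.
case: (reduce p) => [|y q] //= red_q; case: eqP => [->|_] //=.
rewrite -/(reduce (labeling q)) dlab_flip.
by rewrite push_flipK // reduced_reduce.
Qed.

End Walks.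

Lemma null_homotopicP n (tau : seq (letter 'I_n)) :
  null_homotopic tau <-> reduce tau = [::].
Proof.
have tau_walk : walk (X := rose n) tt tau tt.
  elim: tau => //= d p IH.
  by case: (@dtgt _ (rose n) d); case: (@dsrc _ (rose n) d); rewrite IH.
split=> [/homotopic_reduce //|red0].
by rewrite /null_homotopic -red0; apply: homotopic_reducer.
Qed.

(** * Elements of a cyclic subgroup *)

Section Generated.
Variables (n : nat).
Implicit Types (u g : freegrp 'I_n).

Lemma fgword_mul u g : fgword (u * g) = reduce (fgword u ++ fgword g).
Proof. by []. Qed.

Lemma fgword_inv u : fgword (u^-1) = invw (fgword u).
Proof. by []. Qed.

Lemma fgword_exp u k : fgword (u ^+ k) = reduce (wpow k (fgword u)).
Proof.
elim: k => [|k IH] //.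
by rewrite expgS fgword_mul IH /= reduce_catr.
Qed.

Lemma fg_eq1 u : fgword u = [::] -> u = 1.
Proof. by move=> u0; apply: val_inj. Qed.

Lemma smallest_subgroup (A : groupType) (S K : set A) (x : A) :
  is_subgroup K -> S `<=` K -> generated S x -> K x.
Proof. by move=> Kg SK; apply; split. Qed.

Lemma is_subgroupP (A : groupType) (K : set A) :
  K 1 -> (forall x y, K x -> K y -> K (x * y^-1)) -> is_subgroup K.
Proof.
move=> K1 KM; split; first exact/mem_set.
by move=> x y /set_mem xK /set_mem yK; apply/mem_set/KM.
Qed.

Lemma expg_cyclic_sub (A : groupType) (g : A) i j :
  exists k, g ^+ i * g ^- j = g ^+ k \/ g ^+ i * g ^- j = g ^- k.
Proof.
have [le_ji|/ltnW le_ij] := leqP j i.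
  by exists (i - j); left; rewrite -{1}(subnK le_ji) expgnDr mulgK.
by exists (j - i); right; rewrite -{1}(subnK le_ij) expgnDr invgM mulVKg.
Qed.

Lemma generated1P (A : groupType) (g u : A) :
  generated [set g] u -> exists k, u = g ^+ k \/ u = g ^- k.
Proof.
(* Quotients of natural powers stand for integer powers; they form a subgroup because powers of [g]
   commute. *)
move=> gu; suff [i [j ->]] : [set u | exists i j, u = g ^+ i * g ^- j] u.
  exact: expg_cyclic_sub.
apply: smallest_subgroup gu => [|x ->]; last first.
  by exists 1%N, 0%N; rewrite expg1 expg0 invg1 mulg1.
apply: is_subgroupP => [|x y [i [j ->]] [i' [j' ->]] /=].
  by exists 0%N, 0%N; rewrite expg0 invg1 mulg1.
exists (i + j'), (j + i'); rewrite invgM invgK expgnDr addnC expgnDr invgM.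
have : commute (g ^- j) (g ^+ j').
  by apply/commute_sym/commuteV/commuteX2.
by move=> /commute_sym c; rewrite -!mulgA; congr (_ * _); rewrite !mulgA c.
Qed.

Lemma generated1_size g u : generated [set g] u -> u <> 1 ->
  size (fgword g) <= size (fgword u).
Proof.
case/generated1P=> -[|k] [->|->]; rewrite ?expg0 ?invg1 // ?fgword_inv ?size_invw => _;
  by rewrite fgword_exp size_reduce_wpow // fgwordP.
Qed.

End Generated.

(** * Immersions and coverings *)

Section Morphisms.
Variables (n : nat) (X Y : lgraph n).
Variables (fv : vertex X -> vertex Y) (fe : edge X -> edge Y).
Hypothesis src_fe : forall e, src (fe e) = fv (src e).
Hypothesis tgt_fe : forall e, tgt (fe e) = fv (tgt e).
Hypothesis lab_fe : forall e, lab (fe e) = lab e.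

Definition dmap (d : dart X) : dart Y := (fe d.1, d.2).

Lemma dsrc_dmap d : dsrc (dmap d) = fv (dsrc d).
Proof. by case: d => e []; rewrite /dsrc /= ?src_fe ?tgt_fe. Qed.

Lemma dtgt_dmap d : dtgt (dmap d) = fv (dtgt d).
Proof. by case: d => e []; rewrite /dtgt /= ?src_fe ?tgt_fe. Qed.

Lemma dlab_dmap d : dlab (dmap d) = dlab d.
Proof. by rewrite /dlab /= lab_fe. Qed.

Lemma labeling_dmap p : labeling (map dmap p) = labeling p.
Proof. by rewrite /labeling -map_comp; apply: eq_map => d /=; rewrite dlab_dmap. Qed.

Lemma walk_dmap v p w : walk v p w -> walk (fv v) (map dmap p) (fv w).
Proof.
elim: p v => [|d p IH] v /=; first by move=> /eqP->.
by rewrite dsrc_dmap dtgt_dmap => /andP[/eqP-> /IH ->]; rewrite eqxx.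
Qed.

Lemma walk_dmap_inj v p w : injective fv ->
  walk (fv v) (map dmap p) (fv w) = walk v p w.
Proof.
move=> fvI; elim: p v => [|d p IH] v /=; first by rewrite (inj_eq fvI).
by rewrite dsrc_dmap dtgt_dmap (inj_eq fvI) IH.
Qed.

Lemma noback_dmap d d' : injective fe -> noback (dmap d) (dmap d') = noback d d'.
Proof.
by move=> feI; case: d d' => [e b] [e' b']; rewrite /noback !xpair_eqE (inj_eq feI).
Qed.

Lemma cyc_reduced_dmap p : injective fe -> cyc_reduced (map dmap p) = cyc_reduced p.
Proof.
move=> feI; case: p => [//|d p]; rewrite /cyc_reduced /= -map_rcons path_map.
by apply: eq_path => x y; apply: noback_dmap.
Qed.

End Morphisms.
Arguments dmap {n X Y} fe d.

Section Immersions.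
Variables (n : nat) (X : lgraph n).
Implicit Types (d : dart X) (p q : gpath X) (S : pred (edge X)).

(** Local injectivity of the labeling, relative to a set of edges: at the basepoint of the wedge,
    edges of different sides may carry the same label, so each side is treated separately. *)
Definition immersed_on S := forall d d', S d.1 -> S d'.1 ->
  dsrc d = dsrc d' -> dlab d = dlab d' -> d = d'.

Definition edges_in S p := all (fun d => S d.1) p.

Lemma edges_in_cat S p q : edges_in S (p ++ q) = edges_in S p && edges_in S q.
Proof. exact: all_cat. Qed.

Lemma edges_in_reduce S p : edges_in S p -> edges_in S (reduce p).
Proof. by move=> /allP Sp; apply/allP => d /(mem_subseq (reduce_subseq p))/Sp. Qed.

Lemma immersed_noback S d d' : immersed_on S -> S d.1 -> S d'.1 ->
  dtgt d = dsrc d' -> noback d d' -> noback (dlab d) (dlab d').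
Proof.
move=> immS Sd Sd' dd'; apply: contra => /eqP labE; apply/eqP.
by apply: immS => //; rewrite ?dsrc_flip ?dlab_flip.
Qed.

Lemma immersed_reduced S v p w : immersed_on S -> edges_in S p -> walk v p w ->
  reduced p -> reduced (labeling p).
Proof.
move=> immS; elim: p v => [|d [|d' p] IH] v //= /andP[Sd Sp] /andP[_ pw].
move=> /andP[dd' red_p]; have [/eqP d'd _] := andP pw; have [Sd' _] := andP Sp.
apply/andP; split; first exact: (immersed_noback immS).
exact: IH pw red_p.
Qed.

(** Unique lifting: the starting vertex and the labels determine one dart after the other. *)
Lemma immersed_lift_uniq S v p q w w' : immersed_on S ->
  edges_in S p -> edges_in S q -> walk v p w -> walk v q w' ->
  labeling p = labeling q -> p = q.
Proof.
move=> immS; elim: p q v => [|d p IH] [|d' q] v //=.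
move=> /andP[Sd Sp] /andP[Sd' Sq] /andP[/eqP dv pw] /andP[/eqP d'v qw].
case=> labE sgnE pqE; have dd' : d = d'.
  by apply: immS => //; rewrite ?dv // /dlab labE sgnE.
by rewrite -dd' in qw *; rewrite (IH q (dtgt d)).
Qed.

End Immersions.

Section FreeGroupWords.
Variable n : nat.

Definition fgred (p : seq (letter 'I_n)) : freegrp 'I_n :=
  FreeGrp (reduced_reduce p).

Definition fglet (x : letter 'I_n) : freegrp 'I_n := fgred [:: x].

Lemma fgred_nil : fgred [::] = 1.
Proof. exact: val_inj. Qed.

Lemma fgred_cat p q : fgred (p ++ q) = fgred p * fgred q.
Proof. by apply: val_inj; rewrite /= reduce_catl reduce_catr. Qed.

Lemma fgred_cons x p : fgred (x :: p) = fglet x * fgred p.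
Proof. exact: (fgred_cat [:: x]). Qed.

Lemma fgred_id (u : freegrp 'I_n) : fgred u = u.
Proof. by apply: val_inj; rewrite /= reduce_id // fgwordP. Qed.

Lemma fgred_reduce p : fgred (reduce p) = fgred p.
Proof. by apply: val_inj; rewrite /= reduce_idem. Qed.

Lemma fgred_invw p : fgred (invw p) = (fgred p)^-1.
Proof.
apply: (@mulgI _ (fgred p)); rewrite mulgV -fgred_cat -fgred_nil.
by apply: val_inj; rewrite /= reduce_catV.
Qed.

Lemma fglet_flip x : fglet (flip x) = (fglet x)^-1.
Proof. exact: (fgred_invw [:: x]). Qed.

Lemma fglet_gen i : fglet (i, true) = fg_gen i.
Proof. exact: val_inj. Qed.

End FreeGroupWords.

(** * Lifting words to the covering *)

Section CoveringPaths.
Variables (n : nat) (K : set (freegrp 'I_n)).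
Hypothesis K_grp : is_subgroup K.
Implicit Types (v w : vertex (cov K)) (d : dart (cov K)) (p : gpath (cov K)).

Lemma subgroup1 : K 1. Proof. by case: K_grp => /set_mem. Qed.

Lemma subgroupM x y : K x -> K y -> K (x * y).
Proof. by move=> xK yK; apply/set_mem/(group_closedM K_grp); apply/mem_set. Qed.

Lemma subgroupV x : K x -> K x^-1.
Proof. by move=> xK; apply/set_mem/(group_closedV K_grp)/mem_set. Qed.

Lemma translate1 (A : set (freegrp 'I_n)) : translate 1 A = A.
Proof.
by rewrite /translate; apply/seteqP; split=> [_ [x xA <-]|x xA];
  rewrite /= ?mulg1 //; exists x; rewrite ?mulg1.
Qed.

Lemma translateM a b (A : set (freegrp 'I_n)) :
  translate b (translate a A) = translate (a * b) A.
Proof.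
by rewrite /translate image_comp; apply: eq_imagel => x _ /=; rewrite mulgA.
Qed.

Lemma cov_step d : val (dtgt d) = translate (fglet (dlab d)) (val (dsrc d)).
Proof.
case: d => [[v i] []]; rewrite /dlab /dtgt /dsrc /= ?fglet_gen //.
by rewrite (fglet_flip (i, true)) fglet_gen translateM mulgV translate1.
Qed.

Lemma cov_walk v p w :
  walk v p w -> val w = translate (fgred (labeling p)) (val v).
Proof.
elim: p v => [|d p IH] v /=; first by move=> /eqP->; rewrite fgred_nil translate1.
by move=> /andP[/eqP dv /IH->]; rewrite fgred_cons cov_step translateM dv.
Qed.

Lemma cov_lift_dart v x : exists2 d : dart (cov K), dsrc d = v & dlab d = x.
Proof.
case: x => i []; first by exists ((v, i), true).
pose u : vertex (cov K) :=
  Sub (translate (fg_gen i)^-1 (val v)) (is_rcos_translate _ (valP v)).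
exists ((u, i), false) => //; apply: val_inj => /=.
by rewrite translateM mulVg translate1.
Qed.

Lemma cov_lift v (l : seq (letter 'I_n)) :
  exists p w, walk v p w /\ labeling p = l.
Proof.
elim: l v => [|x l IH] v; first by exists [::], v; rewrite /= eqxx.
have [d dv dx] := cov_lift_dart v x; have [p [w [pw pl]]] := IH (dtgt d).
by exists (d :: p), w; rewrite /= dv eqxx pw dx pl.
Qed.

Lemma rcos1E : rcos K 1 = K.
Proof.
by rewrite /rcos; apply/seteqP; split=> [_ [x xA <-]|x xA];
  rewrite /= ?mulg1 //; exists x; rewrite ?mulg1.
Qed.

Lemma cov_closed p : walk (base (cov K)) p (base (cov K)) -> K (fgred (labeling p)).
Proof.
move=> /cov_walk; rewrite /= rcos1E => KE.
suff : translate (fgred (labeling p)) K (fgred (labeling p)) by rewrite -KE.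
by exists 1; [exact: subgroup1 | rewrite mul1g].
Qed.

(** The lift of [u] ends at the coset [K u], which is [K]. *)
Lemma cov_lift_closed u : K u ->
  exists2 p, walk (base (cov K)) p (base (cov K)) & labeling p = u.
Proof.
move=> uK; have [p [w [pw pu]]] := cov_lift (base (cov K)) u.
exists p => //; suff wb : w = base (cov K) by rewrite wb in pw.
apply: val_inj; rewrite (cov_walk pw) pu fgred_id /= rcos1E.
apply/seteqP; split=> [_ [x xK <-]|x xK]; first exact: subgroupM.
by exists (x * u^-1); rewrite ?mulgVK //; apply: subgroupM xK (subgroupV uK).
Qed.

(** For darts crossed backwards, the initial cosets agree because translation by a generator is
    invertible. *)
Lemma cov_immersed : immersed_on (X := cov K) predT.
Proof.
move=> [[v i] b] [[v' i'] b'] _ _; rewrite /dlab /dsrc /= => vE [iE bE].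
subst i' b'; case: b vE => [->//|/(congr1 val) /= vE].
suff -> : v = v' by [].
apply: val_inj; have := congr1 (translate (fg_gen i)^-1) vE.
by rewrite !translateM mulgV !translate1.
Qed.

(* A reduced loop is the reduction of a product of lifts of the generators, so it
   only crosses edges of these lifts. *)
Lemma core_star_edges_finite : finitely_generated K -> finite_set (@core_star_edges _ K).
Proof.
case=> S KE.
have [E0 SE0] : exists E0 : seq (edge (cov K)), forall s, s \in S ->
    exists p, [/\ walk (base (cov K)) p (base (cov K)), labeling p = s
                & {subset [seq d.1 | d <- p] <= E0}].
  have : forall s, s \in S -> K s by move=> s sS; rewrite KE => A [_]; apply.
  elim: S {KE} => [|s S IH] SK; first by exists [::].
  have [|E0 SE0] := IH; first by move=> t tS; apply: SK; rewrite inE tS orbT.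
  have [p pw ps] := cov_lift_closed (SK s (mem_head s S)).
  exists ([seq d.1 | d <- p] ++ E0) => t; rewrite inE => /predU1P[->|/SE0[q [qw qt sq]]].
    by exists p; split=> // e; rewrite mem_cat => ->.
  by exists q; split=> // e /sq; rewrite mem_cat orbC => ->.
apply: (@sub_finite_set _ _ [set` E0]); last exact: finite_seq.
move=> e [p [pw red_p ep]].
(* The elements represented by closed walks inside [E0] form a subgroup containing the generators,
   hence all of [K]. *)
pose K' := [set u | exists q, [/\ walk (base (cov K)) q (base (cov K)),
  {subset [seq d.1 | d <- q] <= E0} & fgred (labeling q) = u]].
suff [q [qw qE qp]] : K' (fgred (labeling p)).
  have red_lab r : walk (base (cov K)) r (base (cov K)) -> reduced r ->
      reduced (labeling r).
    by move=> rw; apply: (immersed_reduced cov_immersed _ rw); apply/allP.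
  (* Both are reduced closed walks for the same element, so their labels agree and unique lifting
     applies. *)
  suff pE : p = reduce q.
    apply: qE; have /mapP[d dp ->] := ep; rewrite map_f //.
    by apply: (mem_subseq (reduce_subseq q)); rewrite -pE.
  apply: (immersed_lift_uniq cov_immersed _ _ pw (walk_reduce qw)); try exact/allP.
  have := congr1 (@fgword _) qp; rewrite /= -reduce_labeling.
  rewrite (reduce_id (red_lab _ pw red_p)).
  by rewrite (reduce_id (red_lab _ (walk_reduce qw) (reduced_reduce q))).
have : generated [set` S] (fgred (labeling p)) by rewrite -KE; apply: cov_closed.
apply: (@smallest_subgroup _ _ K').
  apply: is_subgroupP => [|_ _ [x [xw xE <-]] [y [yw yE <-]]].
    by exists [::]; split; rewrite //= ?eqxx // fgred_nil.
  exists (x ++ invw y); split; last 1 first.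
  - by rewrite labeling_cat labeling_invw fgred_cat fgred_invw.
  - by apply/walk_catP; exists (base (cov K)) => //; apply: walk_invw.
  move=> f; rewrite map_cat mem_cat => /orP[/xE//|].
  by rewrite /invw map_rev mem_rev -map_comp => /yE.
move=> s /SE0[q [qw qs qE]]; exists q; split=> //.
by rewrite qs fgred_id.
Qed.

End CoveringPaths.

(** * The wedge of the core graphs *)

Lemma count_split (T : eqType) (x : T) s : 1 < count_mem x s ->
  exists A m B, s = A ++ x :: m ++ x :: B.
Proof.
move=> s2; have xs : x \in s by rewrite -has_pred1 has_count ltnW.
case/path.splitPr: xs s2 => A B; rewrite count_cat /= eqxx => AB.
have : (0 < count_mem x A) || (0 < count_mem x B) by lia.
rewrite -!has_count !has_pred1 => /orP[/path.splitPr[A1 A2]|/path.splitPr[B1 B2]].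
  by exists A1, A2, B; rewrite -catA.
by exists A, B1, B2.
Qed.

Lemma dup_split (T : eqType) (s : seq T) : ~~ uniq s ->
  exists A x m B, s = A ++ x :: m ++ x :: B.
Proof.
move=> us; suff [x /count_split[A [m [B ->]]]] : exists x, 1 < count_mem x s.
  by exists A, x, m, B.
elim: s us => //= x s IH; rewrite negb_and negbK -has_pred1 has_count.
by move=> /orP[|/IH[y sy]]; [exists x; rewrite eqxx | exists y; rewrite ltn_addl].
Qed.

Section SpanWedge.
Variable n : nat.

Lemma span_immersed (X : lgraph n) (E : set (edge X)) :
  immersed_on (X := X) predT -> immersed_on (X := span E) predT.
Proof.
move=> immX d d' _ _ srcE labE.
pose valD : dart (span E) -> dart X := dmap (val : edge (span E) -> edge X).
have dsrc_valD x : dsrc (valD x) = val (dsrc x).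
  by rewrite (dsrc_dmap (fv := (val : vertex (span E) -> vertex X))).
have : valD d = valD d'.
  by apply: immX; rewrite ?dsrc_valD ?srcE // /valD !dlab_dmap.
by case: d d' {srcE labE} => [e b] [e' b'] [/val_inj -> ->].
Qed.

Lemma wedge_inr_inj (X Y : lgraph n) : injective (@wedge_inr _ X Y).
Proof.
move=> v v'; rewrite /wedge_inr; case: insubP => [u _ uv|];
  case: insubP => [u' _ u'v'|] //.
  by case=> uu'; rewrite -uv -u'v' uu'.
by rewrite !negbK => /eqP-> /eqP->.
Qed.

Lemma wedge_inr_base (X Y : lgraph n) : @wedge_inr _ X Y (base Y) = inl (base X).
Proof. by rewrite /wedge_inr insubN // eqxx. Qed.

End SpanWedge.

Lemma generated_subgroup (A : groupType) (S : set A) : is_subgroup (generated S).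
Proof.
apply: is_subgroupP => [K [Kg _]|x y xS yS K KS].
  by case: Kg => /set_mem.
have [Kg _] := KS; case: (Kg) => _ KM; apply/set_mem/KM; apply/mem_set.
  exact: xS.
exact: yS.
Qed.

Section WedgeGraph.
Variables (n : nat) (H : set (freegrp 'I_n)) (g : freegrp 'I_n).
Hypothesis H_grp : is_subgroup H.
Let G := wedge_graph H g.
Implicit Types (d : dart G) (p q : gpath G) (v w : vertex G).

Definition left_edge : pred (edge G) := fun e => in_left e.
Definition right_edge : pred (edge G) := fun e => ~~ in_left e.

Let inlD : dart (core_star H) -> dart G := dmap (inl : edge _ -> edge G).
Let inrD : dart (core_star (generated [set g])) -> dart G :=
  dmap (inr : edge _ -> edge G).
Let valD K : dart (@core_star n K) -> dart (cov K) :=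
  dmap (val : edge (core_star K) -> edge (cov K)).

Lemma left_lift p : edges_in left_edge p ->
  exists p' : gpath (core_star H), p = map inlD p'.
Proof.
elim: p => [|[[e|e] b] p IH] //=; first by exists [::].
by move=> /IH[p' ->]; exists ((e, b) :: p').
Qed.

Lemma right_lift p : edges_in right_edge p ->
  exists p' : gpath (core_star (generated [set g])), p = map inrD p'.
Proof.
elim: p => [|[[e|e] b] p IH] //=; first by exists [::].
by move=> /IH[p' ->]; exists ((e, b) :: p').
Qed.

Lemma dsrc_inlD (d : dart (core_star H)) : dsrc (inlD d) = inl (dsrc d).
Proof. exact: dsrc_dmap. Qed.

Lemma dsrc_inrD (d : dart (core_star (generated [set g]))) :
  dsrc (inrD d) = wedge_inr _ (dsrc d).
Proof. exact: dsrc_dmap. Qed.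

Lemma left_immersed : immersed_on left_edge.
Proof.
move=> [[e|e] b] [[e'|e'] b'] // _ _ srcE labE.
suff : (e, b) = (e', b') :> dart (core_star H) by case=> -> ->.
apply: (span_immersed (@cov_immersed n H)) => //.
have : inl (dsrc (e, b)) = inl (dsrc (e', b')) :> vertex G by rewrite -!dsrc_inlD.
by case.
Qed.

Lemma right_immersed : immersed_on right_edge.
Proof.
move=> [[e|e] b] [[e'|e'] b'] // _ _ srcE labE.
suff : (e, b) = (e', b') :> dart (core_star (generated [set g])) by case=> -> ->.
apply: (span_immersed (@cov_immersed n (generated [set g]))) => //.
apply: (@wedge_inr_inj _ (core_star H)).
by rewrite -[LHS]dsrc_inrD -[RHS]dsrc_inrD.
Qed.

Lemma walk_inlD (v w : vertex (core_star H)) (p : gpath (core_star H)) :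
  walk (inl v : vertex G) (map inlD p) (inl w) = walk v p w.
Proof. by apply: walk_dmap_inj => //; apply: inl_inj. Qed.

Lemma walk_inrD (v w : vertex (core_star (generated [set g])))
    (p : gpath (core_star (generated [set g]))) :
  walk (wedge_inr _ v : vertex G) (map inrD p) (wedge_inr _ w) = walk v p w.
Proof. by apply: walk_dmap_inj => //; apply: wedge_inr_inj. Qed.

Lemma walk_valD K (v w : vertex (core_star K)) (p : gpath (core_star K)) :
  walk v p w -> walk (val v) (map (@valD K) p) (val w).
Proof. exact: walk_dmap. Qed.

Lemma left_closed p : edges_in left_edge p -> walk (base G) p (base G) ->
  H (fgred (labeling p)).
Proof.
case/left_lift=> p' ->; rewrite walk_inlD => /walk_valD /(cov_closed H_grp).
by rewrite !labeling_dmap.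
Qed.

Lemma right_closed p : edges_in right_edge p -> walk (base G) p (base G) ->
  generated [set g] (fgred (labeling p)).
Proof.
case/right_lift=> p' ->; rewrite -[base G]wedge_inr_base walk_inrD => /walk_valD.
by move=> /(cov_closed (@generated_subgroup _ _)); rewrite !labeling_dmap.
Qed.

(* The stretch between two passages of a reduced path through the same dart is a
   cyclically reduced loop. *)
Lemma repeated_core v w A d m B : edges_in left_edge (A ++ d :: m ++ d :: B) ->
  walk v (A ++ d :: m ++ d :: B) w -> reduced (A ++ d :: m ++ d :: B) -> in_core d.1.
Proof.
move=> lA /walk_cut_loop dm redA.
have cyc : cyc_reduced (d :: m) := sorted_cut_loop redA.
have /left_lift[[//|d' m'] dmE] : edges_in left_edge (d :: m).
  move: lA; rewrite -cat_cons catA edges_in_cat => /andP[].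
  by rewrite edges_in_cat => /andP[].
move: dm cyc; rewrite dmE; case: dmE => -> _; rewrite dsrc_inlD walk_inlD => dm cyc.
exists (val (dsrc d')), (map (@valD H) (d' :: m')); split.
- exact: walk_valD.
- rewrite cyc_reduced_dmap; last exact: val_inj.
  rewrite -/(cyc_reduced _) cyc_reduced_dmap // in cyc; exact: inl_inj.
- exact: mem_head.
Qed.

Definition core_dart d : bool := `[< in_core d.1 >].

Lemma noncore_uniq v w p : edges_in left_edge p -> walk v p w -> reduced p ->
  uniq [seq d <- p | ~~ core_dart d].
Proof.
move=> lp pw red_p; apply: contraT => /dup_split[A [d [m [B pE]]]].
have dA : d \in [seq d <- p | ~~ core_dart d] by rewrite pE mem_cat mem_head orbT.
have /asboolPn[] : ~~ core_dart d by move: dA; rewrite mem_filter => /andP[].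
(* A repetition among the filtered darts is one in [p] itself, to which [repeated_core] applies. *)
have /count_split[A' [m' [B' pE']]] : 1 < count_mem d p.
  apply: (@leq_trans (count_mem d [seq d <- p | ~~ core_dart d])).
    by rewrite pE !(count_cat, eqxx) /= count_cat /= eqxx; lia.
  exact: leq_count_subseq (filter_subseq _ _).
by rewrite pE' in lp pw red_p; apply: repeated_core lp pw red_p.
Qed.

(* Skipping the stretch between two passages through a dart would leave a shorter
   non-trivial power of [g]. *)
Lemma right_loop_uniq p : walk (base G) p (base G) -> edges_in right_edge p ->
  labeling p = g \/ labeling p = g^-1 -> uniq p.
Proof.
move=> pw rp pg; apply: contraT => /dup_split[A [d [m [B pE]]]]; exfalso.
have szp : size p = size (fgword g).
  rewrite -(size_map (@dlab n G)) -/(labeling p).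
  by case: pg => ->; rewrite ?fgword_inv ?size_invw.
have red_p : reduced p.
  by apply: reduced_of_labeling; case: pg => ->; apply: fgwordP.
have rq : edges_in right_edge (A ++ d :: B).
  move: rp; rewrite pE !edges_in_cat /= edges_in_cat /=.
  by move=> /andP[-> /andP[-> /andP[_ /andP[_ ->]]]].
have qw : walk (base G) (A ++ d :: B) (base G) by apply: (walk_cut (m := m)); rewrite -pE.
have red_q : reduced (A ++ d :: B) by apply: (sorted_cut (m := m)); rewrite -pE.
have red_lq := immersed_reduced right_immersed rq qw red_q.
(* The shortened loop still crosses [d] and its label is reduced, so it is not trivial. *)
have qg : fgred (labeling (A ++ d :: B)) <> 1.
  move=> /(congr1 (@fgword _)); rewrite /= reduce_id // => /(congr1 size).
  by rewrite size_map size_cat /= addnS.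
have := generated1_size (right_closed rq qw) qg.
rewrite /= reduce_id // size_map -szp pE !size_cat /= size_cat /=; lia.
Qed.

End WedgeGraph.

(** * Counting darts and colours in a finite graph *)

Section EdgeCount.
Variables (n : nat) (X : lgraph n).
Hypothesis X_fin : finite_set [set: edge X].

Let all_edges : seq (edge X) := fset_set [set: edge X].

Let mem_all_edges e : e \in all_edges.
Proof. by rewrite /all_edges in_fset_set // inE. Qed.

Lemma uniq_darts_size (s : gpath X) : uniq s -> (size s <= 2 * nb_edges X)%N.
Proof.
move=> us; have /(uniq_leq_size us) : {subset s <=
    [seq (e, b) | e <- all_edges, b <- [:: true; false]]}.
  by move=> [e b] _; apply: allpairs_f => //; case: b.
by rewrite size_allpairs mulnC.
Qed.

Lemma uniq_colours_size (s : seq (dart X * edge X)) : uniq s ->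
  (size s <= 2 * nb_edges X ^ 2)%N.
Proof.
move=> us; have /(uniq_leq_size us) : {subset s <=
    [seq (d, e) | d <- [seq (e, b) | e <- all_edges, b <- [:: true; false]],
                  e <- all_edges]}.
  move=> [[e b] e'] _; apply: allpairs_f => //.
  by apply: allpairs_f => //; case: b.
by rewrite !size_allpairs mulnAC mulnC.
Qed.

End EdgeCount.

Section WedgeFinite.
Variables (n : nat).

Lemma span_finite (X : lgraph n) (E : set (edge X)) :
  finite_set E -> finite_set [set: edge (span E)].
Proof.
case/finite_seqP=> s Es; apply: (@sub_finite_set _ _ [set` pmap insub s]).
  have sE : E `<=` [set` s] by rewrite -Es.
  by move=> e _ /=; rewrite mem_pmap_sub; apply: sE (set_mem (valP e)).
exact: finite_seq.
Qed.

Lemma wedge_finite (X Y : lgraph n) : finite_set [set: edge X] ->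
  finite_set [set: edge Y] -> finite_set [set: edge (wedge X Y)].
Proof.
move=> /finite_seqP[s Xs] /finite_seqP[t Yt].
apply: (@sub_finite_set _ _ [set` map inl s ++ map inr t]); last exact: finite_seq.
move=> [e|e] _ /=; rewrite mem_cat; apply/orP; [left|right]; apply: map_f.
  by have : [set: edge X] e by []; rewrite Xs.
by have : [set: edge Y] e by []; rewrite Yt.
Qed.

Lemma wedge_graph_finite (H : set (freegrp 'I_n)) g : finitely_generated H ->
  finite_set [set: edge (wedge_graph H g)].
Proof.
move=> Hfg; apply: wedge_finite; apply: span_finite; apply: core_star_edges_finite => //.
- by case: Hfg => S ->; apply: generated_subgroup.
- exact: generated_subgroup.
- by exists [:: g]; congr generated; apply/seteqP; split=> x /=; rewrite inE => /eqP.
Qed.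

End WedgeFinite.

(** * Equations and their paths *)

Section BlockPaths.
Variables (n : nat) (H : set (freegrp 'I_n)) (g : freegrp 'I_n).
Hypothesis H_grp : is_subgroup H.
Hypothesis g_neq1 : g <> 1.
Let G := wedge_graph H g.
Implicit Types (p q r : gpath G) (w : seq (syllable n)).

Definition starts_coef w := if w is inr _ :: _ then true else false.
Definition starts_var w := if w is inl _ :: _ then true else false.

Definition var_count w :=
  count (fun s : syllable n => if s is inl _ then true else false) w.

(* [p] is the reduced path of the equation [w], decomposed into its maximal
   subpaths in one side of the wedge: such a subpath corresponds to a
   coefficient or to a maximal power of [x]. *)
Inductive block_path : seq (syllable n) -> gpath G -> Prop :=
| block_nil : block_path [::] [::]
| block_left h w p q : H h -> h <> 1 ->
    walk (base G) p (base G) -> edges_in (@left_edge n H g) p ->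
    labeling p = h -> ~~ starts_coef w -> block_path w q ->
    block_path (inr h :: w) (p ++ q)
| block_right b k r w q : theta_path (nseq k.+1 (inl b)) r -> reduce r <> [::] ->
    edges_in (@right_edge n H g) r -> ~~ starts_var w -> block_path w q ->
    block_path (nseq k.+1 (inl b) ++ w) (reduce r ++ q).

Lemma theta_path_walk w q : theta_path w q -> walk (base G) q (base G).
Proof.
elim: w q => [|s w IH] q; first by move=> ->; rewrite /= eqxx.
case=> p1 [p2 [-> [p1w _] /IH p2w]]; apply/walk_catP.
by exists (base G).
Qed.

Lemma theta_path_cat w w' q q' :
  theta_path w q -> theta_path w' q' -> theta_path (w ++ w') (q ++ q').
Proof.
elim: w q => [|s w IH] q; first by move=> ->.
case=> p1 [p2 [-> sp1 p2w]] q'w'; exists p1, (p2 ++ q').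
by split; rewrite ?catA //; apply: IH.
Qed.

Lemma theta_path_split w w' r : theta_path (w ++ w') r ->
  exists q q', [/\ r = q ++ q', theta_path w q & theta_path w' q'].
Proof.
elim: w r => [|s w IH] r; first by exists [::], r.
case=> p1 [p2 [-> sp1 /IH[q [q' [-> wq w'q']]]]].
by exists (p1 ++ q), q'; split; rewrite ?catA //; exists p1, q.
Qed.

Lemma theta_path_phi w q : theta_path w q -> fgred (labeling q) = phi g w.
Proof.
elim: w q => [|s w IH] q; first by move=> ->; rewrite /phi big_nil fgred_nil.
case=> p1 [p2 [-> [_ sp1] /IH p2w]].
rewrite labeling_cat fgred_cat p2w /phi big_cons; congr (_ * _).
by case: s sp1 => [b|h] [_ ->]; rewrite fgred_id.
Qed.

Lemma theta_path_right k b r : theta_path (nseq k (inl b)) r ->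
  edges_in (@right_edge n H g) r.
Proof.
elim: k r => [|k IH] r /=; first by move=> ->.
by case=> p1 [p2 [-> [_ [rp1 _]] /IH rp2]]; rewrite edges_in_cat rp2 andbT.
Qed.

Lemma block_starts w p : block_path w p ->
  starts_coef w = starts_in (@left_edge n H g) p /\
  starts_var w = starts_in (@right_edge n H g) p.
Proof.
elim=> {w p} [//|h w p q _ h1 _ lp ph _ _ _|b k r w q _ r0 rr _ _ _].
  case: p lp ph => [|d p] /= => [_ /esym/fg_eq1//|/andP[ld _] _].
  by rewrite ld /right_edge [in_left _]ld.
have := edges_in_reduce rr; case: (reduce r) r0 => [//|d p] _ /= /andP[rd _].
by rewrite rd /left_edge (negbTE rd).
Qed.

Lemma block_walk w p : block_path w p -> walk (base G) p (base G).
Proof.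
elim=> {w p} [|h w p q _ _ pw _ _ _ _ qw|b k r w q rw _ _ _ _ qw] /=.
- exact: eqxx.
- by apply/walk_catP; exists (base G).
- by apply/walk_catP; exists (base G) => //; apply: walk_reduce (theta_path_walk rw).
Qed.

Lemma block_reduced w p : block_path w p -> reduced p.
Proof.
elim=> {w p} [//|h w p q _ _ _ lp ph cw wq qr|b k r w q _ _ rr cw wq qr].
  apply: reduced_cat_sides lp _ => //; last by have [<- _] := block_starts wq.
  by apply: reduced_of_labeling; rewrite ph fgwordP.
apply: reduced_cat_sides (edges_in_reduce rr) _ => //; first exact: reduced_reduce.
by have [_ <-] := block_starts wq.
Qed.

Lemma block_theta w p : block_path w p -> exists2 q, theta_path w q & reduce q = p.
Proof.
move=> wp; suff [q wq qp] : exists2 q, theta_path w q & reduce q = reduce p.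
  by exists q; rewrite // qp reduce_id ?(block_reduced wp).
elim: wp => {w p} [|h w p q _ _ pw lp ph cw wq [q' wq' q'q]|
  b k r w q wr _ rr cw _ [q' wq' q'q]].
- by exists [::].
- exists (p ++ q'); last by rewrite -(reduce_catr p q') q'q reduce_catr.
  by exists p, q'.
- exists (r ++ q'); first exact: theta_path_cat.
  by rewrite reduce_catl -(reduce_catr r q') q'q reduce_catr.
Qed.

Lemma block_corresponding w p : block_path w p -> corresponding_path w p.
Proof.
move=> wp; split; [exact: block_walk wp | exact: block_reduced wp |].
have [q wq <-] := block_theta wp; exists q => //.
exact/homotopic_reducer/theta_path_walk/wq.
Qed.

Lemma block_equation w p : block_path w p -> is_equation H w.
Proof.
elim=> {w p} [//|h w p q Hh h1 _ _ _ cw _ [sw cof]|b k r w q _ _ _ cw _ [sw cof]].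
  split; first by case: w cw sw {cof} => [|[b|h'] w].
  by move=> h'; rewrite inE => /orP[/eqP[->]|/cof].
split; last first.
  move=> h; rewrite mem_cat => /orP[|/cof//].
  by rewrite mem_nseq => /andP[_ /eqP].
elim: k => [|k IH] /=; first by case: w cw sw {cof} => [|[b'|h'] w].
by rewrite -/(nseq k.+1 _) in IH *; move: IH => /= ->; case: b.
Qed.

Lemma block_phi w p : block_path w p -> fgred (labeling p) = phi g w.
Proof.
case/block_theta=> q wq <-; rewrite -fgred_reduce reduce_labeling fgred_reduce.
exact: theta_path_phi.
Qed.

Lemma split_vars b w : sorted (@syl_adj n) (inl b :: w) ->
  exists k w', inl b :: w = nseq k.+1 (inl b) ++ w' /\ ~~ starts_var w'.
Proof.
elim: w => [|[b'|h] w IH]; first by exists 0%N, [::].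
  move=> /= /andP[bb' sw]; have bE : b' = b by case: b b' bb' {IH sw} => [] [].
  rewrite bE in sw *; have [k [w' [wE sw']]] := IH sw.
  by exists k.+1, w'; rewrite wE.
by exists 0%N, (inr h :: w).
Qed.

(** A positive power of [g] or of its inverse is no shorter than [g], hence not trivial. *)
Lemma theta_vars_neq0 k b r : theta_path (nseq k.+1 (inl b)) r -> reduce r <> [::].
Proof.
move=> /theta_path_phi rg r0; apply: g_neq1; apply: fg_eq1; apply: size0nil.
apply/eqP; rewrite -leqn0.
have prodE m : phi g (nseq m (inl b)) = (if b then g else g^-1) ^+ m.
  rewrite /phi; elim: m => [|m IH]; first by rewrite big_nil.
  by rewrite big_cons IH expgS.
have := size_reduce_wpow k (fgwordP (if b then g else g^-1)).
rewrite -fgword_exp -prodE -rg -fgred_reduce -reduce_labeling r0.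
by case: b {rg prodE} => //; rewrite fgword_inv size_invw.
Qed.

(** Consecutive blocks lie on different sides of the wedge, so nothing cancels across them:
    reduction only acts inside a power of [x]. *)
Lemma theta_block w q : is_equation H w -> theta_path w q -> block_path w (reduce q).
Proof.
have [m] := ubnP (size w); elim: m w q => // m IH [|s w] q sz [sw cof].
  by move=> ->; apply: block_nil.
case: s sz sw cof => [b|h] sz sw cof.
  have [k [w' [wE cw']]] := split_vars sw; rewrite wE in sz sw cof *.
  case/theta_path_split=> r [q' [-> kr w'q']].
  have red_w' : sorted (@syl_adj n) w' by case/cat_sorted2: sw.
  have wq' : block_path w' (reduce q').
    apply: IH => //; first by rewrite size_cat size_nseq in sz; lia.
    by split=> // h hw'; apply: cof; rewrite mem_cat hw' orbT.
  have rr := theta_path_right kr.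
  suff -> : reduce (r ++ q') = reduce r ++ reduce q'.
    by apply: block_right => //; apply: theta_vars_neq0 kr.
  rewrite -reduce_catl -reduce_catr reduce_id //.
  apply: reduced_cat_sides (edges_in_reduce rr) _; rewrite ?reduced_reduce //.
  by have [_ <-] := block_starts wq'.
case=> p [q' [-> [pw [lp ph]] w'q']].
have cw' : ~~ starts_coef w by case: w sw {sz cof w'q'} => [|[]].
have wq' : block_path w (reduce q').
  apply: IH => //; split; first exact: path_sorted sw.
  by move=> h' hw; apply: cof; rewrite inE hw orbT.
have [Hh h1] := cof h (mem_head _ _).
have red_p : reduced p by apply: reduced_of_labeling; rewrite ph fgwordP.
suff -> : reduce (p ++ q') = p ++ reduce q' by apply: block_left.
rewrite -reduce_catr reduce_id //; apply: reduced_cat_sides (lp) _ => //.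
  exact: reduced_reduce.
by have [<- _] := block_starts wq'.
Qed.

Lemma corresponding_block w p : is_equation H w -> corresponding_path w p ->
  block_path w p.
Proof.
move=> weq [pw red_p [q wq /homotopic_reduce]]; rewrite (reduce_id red_p) => <-.
exact: theta_block.
Qed.

Lemma cat_eq_catP (T : Type) (a b c d : seq T) : a ++ b = c ++ d ->
  (exists2 c', c = a ++ c' & b = c' ++ d) \/
  (exists x a', a = c ++ x :: a' /\ d = x :: a' ++ b).
Proof.
elim: a c => [|x a IH] [|y c] /=.
- by left; exists [::].
- by move=> ->; left; exists (y :: c).
- by move=> <-; right; exists x, a.
by case=> -> /IH[[c' -> ->]|[z [a' [-> ->]]]]; [left; exists c'|right; exists z, a'].
Qed.

Lemma head_cat (T : Type) (x0 : T) s t : head x0 (s ++ t) = head (head x0 t) s.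
Proof. by case: s. Qed.

Lemma head_map_cut (T U : Type) (f : T -> U) x0 A s m C :
  head x0 (map f (A ++ s :: C)) = head x0 (map f (A ++ s :: m ++ s :: C)).
Proof. by case: A. Qed.

Lemma last_map_cut (T U : Type) (f : T -> U) x0 A s m C :
  last x0 (map f (A ++ s :: C)) = last x0 (map f (A ++ s :: m ++ s :: C)).
Proof. by rewrite !map_cat /= !last_cat /= map_cat last_cat. Qed.

Lemma eq_word_cat w w' : eq_word (w ++ w') = eq_word w ++ eq_word w'.
Proof. by rewrite /eq_word map_cat flatten_cat. Qed.

Lemma eq_word_coef h w :
  eq_word (inr h :: w) = [seq (Some a.1, a.2) | a <- fgword h] ++ eq_word w.
Proof. by []. Qed.

(** The removed stretch lies on the left side, hence in the path of a single coefficient. That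
    coefficient becomes another element of [H], non-trivial because the dart [s] is kept, with the
    same first and last letters. The control of both ends is what lets cyclic reducedness
    survive. *)
Lemma block_cut w A s m C : block_path w (A ++ s :: m ++ s :: C) ->
  edges_in (@left_edge n H g) (s :: m) ->
  exists w', [/\ block_path w' (A ++ s :: C), var_count w' = var_count w,
    starts_coef w' = starts_coef w, starts_var w' = starts_var w &
    forall x0, head x0 (eq_word w') = head x0 (eq_word w) /\
               last x0 (eq_word w') = last x0 (eq_word w)].
Proof.
move PE: (A ++ s :: _) => P wP; move/esym in PE; move=> lsm.
have [ls lm] := andP lsm; elim: wP A PE => {w P}; first by case.
- move=> h w p q Hh h1 pw lp ph cw wq IH A /cat_eq_catP[[A' -> qE]|[x [p2 [pE EE]]]].
    have [w' [w'q cE rE vE hE]] := IH A' qE.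
    exists (inr h :: w'); split=> //.
    + by rewrite -catA; apply: block_left => //; rewrite rE.
    + by move=> x0; rewrite !eq_word_coef !head_cat !last_cat !(hE _).1 !(hE _).2.
  case: EE => xE; rewrite -{}xE in pE *.
  (* The stretch cannot run past the end of [p]: the next block does not begin on the left side,
     whereas [s] and all of [m] are there. *)
  move=> /cat_eq_catP[[m' p2E qE]|[y [m2 [mE qE]]]]; last first.
    have [sq _] := block_starts wq; move: cw; rewrite sq qE /=.
    by have /allP/(_ y) := lm; rewrite mE mem_cat mem_head orbT => /(_ isT) ->.
  case: m' p2E qE => [|y C1] p2E.
    move=> qE; have [sq _] := block_starts wq; move: cw; rewrite sq.
    by rewrite cat0s in qE; rewrite -qE /= ls.
  case=> yE CE; rewrite CE {CE}; rewrite p2E -yE in pE.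
  have pw' : walk (base G) (A ++ s :: C1) (base G).
    by apply: (walk_cut (m := m)); rewrite -pE.
  have lp' : edges_in (@left_edge n H g) (A ++ s :: C1).
    by move: lp; rewrite pE !edges_in_cat /= edges_in_cat /= => /and5P[-> -> _ _ ->].
  have red_p' : reduced (A ++ s :: C1).
    apply: (sorted_cut (m := m)); rewrite -pE.
    by apply: reduced_of_labeling; rewrite ph fgwordP.
  have red_l' := immersed_reduced (@left_immersed n H g) lp' pw' red_p'.
  have h'E : labeling (A ++ s :: C1) = fgred (labeling (A ++ s :: C1)).
    by rewrite /= reduce_id.
  set h' := fgred _ in h'E.
  exists (inr h' :: w); split=> //.
  - have -> : A ++ s :: C1 ++ q = (A ++ s :: C1) ++ q by rewrite -catA.
    apply: block_left => //; first exact: left_closed.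
    by move=> h'1; move/(congr1 size): h'E; rewrite h'1 size_map size_cat addnS.
  - move=> x0; rewrite !eq_word_coef -h'E -ph pE !head_cat !last_cat.
    by rewrite /labeling -!map_comp (head_map_cut _ _ _ _ m) (last_map_cut _ _ _ _ m).
move=> b k r w q kr r0 rr cw wq IH A.
(* The path of a power of [x] has all its darts on the right, so the cut takes place in the later
   blocks. *)
case/cat_eq_catP=> [[A' -> qE]|[x [r' [rE [sx _]]]]]; last first.
  have := edges_in_reduce rr; rewrite rE edges_in_cat /= -sx => /andP[_].
  by rewrite /right_edge [in_left _]ls.
have [w' [w'q cE rE vE hE]] := IH A' qE.
exists (nseq k.+1 (inl b) ++ w'); split=> //.
- by rewrite -catA; apply: block_right => //; rewrite vE.
- by rewrite /var_count !count_cat; congr (_ + _)%N.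
- by move=> x0; rewrite !eq_word_cat !head_cat !last_cat !(hE _).1 !(hE _).2.
Qed.

End BlockPaths.

(** * Degree and cyclic reduction of equations *)

Section Degree.
Variables (n : nat) (H : set (freegrp 'I_n)).
Implicit Types (w : seq (syllable n)).

Definition coef_count w :=
  count (fun s : syllable n => if s is inr _ then true else false) w.

(** Coefficients are never adjacent, so each one, except possibly the first, follows its own letter
    [x] or [x^-1]. *)
Lemma coef_count_le w : sorted (@syl_adj n) w ->
  coef_count w <= var_count w + starts_coef w.
Proof.
elim: w => [//|[b|h] w IH] sw; have := IH (path_sorted sw);
  rewrite /coef_count /var_count /= => {}IH; first by case: (starts_coef w) IH => /=; lia.
have cw : starts_coef w = false by case: w sw {IH} => [|[]].
by rewrite cw in IH; lia.
Qed.

Lemma equation_behead s w : is_equation H (s :: w) -> is_equation H w.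
Proof.
move=> [sw cof]; split; first exact: path_sorted sw.
by move=> h hw; apply: cof; rewrite inE hw orbT.
Qed.

Lemma eq_word_reduced w : is_equation H w -> reduced (eq_word w).
Proof.
elim: w => [//|s w IH] weq; have red_w := IH (equation_behead weq).
have [sw cof] := weq.
case: s sw cof {weq} => [b|h] sw cof.
  case: w sw cof red_w {IH} => [//|[b'|h] w] sw cof red_w.
    rewrite /reduced /= -/(eq_word _) in red_w *; rewrite red_w andbT.
    by move: sw => /= /andP[bb' _]; apply: contra bb' => /eqP[->].
  apply: (@reduced_cat_sides _ (pred1 None) [:: (None, b)] (eq_word (inr h :: w))) => //.
  have [_ h1] : H h /\ h <> 1 by apply: cof; rewrite !inE eqxx orbT.
  rewrite eq_word_coef.
  case hE: (fgword h) => [|x l] //.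
  by case: h1; apply: fg_eq1.
rewrite eq_word_coef; apply: (@reduced_cat_sides _ isSome) => //.
- rewrite /reduced sorted_map; have := fgwordP h.
  apply: sub_sorted => -[i b] [j c].
  by apply: contra => /eqP[-> ->].
- by rewrite all_map; apply/allP.
- by case: w sw {cof red_w IH} => [|[b|h'] w].
Qed.

(** The ends of such a word carry neither opposite letters [x] nor inverse coefficients. Cyclic
    reduction in the free product can therefore only merge the first coefficient into the last,
    which keeps the letters [x]. *)
Lemma degree_var_count w : is_equation H w -> cyc_reduced_equation w ->
  degree w = var_count w.
Proof.
move=> weq cyc; rewrite /degree /cyc_reduction -/(var_count _).
case: w weq cyc => [|s [|t w]] //= weq cyc.
set mid := belast t w; set e := last t w.
have wE : s :: t :: w = rcons (s :: mid) e by rewrite /= /mid /e -lastI.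
have [x0 ew0] : exists x0, x0 \in eq_word (s :: t :: w).
  have [_ cof] := weq.
  case: s {cyc weq wE} cof => [b|h] cof; first by exists (None, b); rewrite inE eqxx.
  have [_] := cof h (mem_head _ _); case hE: (fgword h) => [|x l] h1.
    by case: h1; apply: fg_eq1.
  by exists (Some x.1, x.2); rewrite eq_word_coef hE inE eqxx.
have nb : noback (last x0 (eq_word (s :: t :: w))) (head x0 (eq_word (s :: t :: w))).
  have e0 : eq_word [:: s, t & w] != [::] by apply: contraTneq ew0 => ->.
  by move: cyc; rewrite /cyc_reduced_equation (cyc_reducedE x0 e0) => /andP[].
have [_ cof] := weq.
have lastE : last x0 (eq_word (s :: t :: w)) =
    last (last x0 (eq_word (s :: mid))) (eq_word [:: e]).
  by rewrite wE -cats1 eq_word_cat last_cat.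
case: s cof wE nb lastE {weq cyc ew0} => [b|h] cof wE nb lastE.
  case eE: e lastE => [b'|k] // lastE; case: eqP => // bb'.
  by move: nb; rewrite lastE /= /noback /flip bb' /= negbK eqxx.
case eE: e lastE => [b'|k] // lastE.
have var_mid : var_count mid = var_count (inr h :: t :: w).
  by rewrite wE -cats1 /var_count count_cat eE /= add0n !addn0.
case: eqP => [kh1|_]; last first.
  rewrite -[RHS]/(var_count (inr h :: t :: w)) -var_mid -cats1 /var_count count_cat /=.
  by rewrite !addn0.
have hE : h = k^-1 by apply/esym/mulg1_eq.
have [_ h1] := cof h (mem_head _ _).
have ek : eq_word [:: inr k] = [seq (Some a.1, a.2) | a <- fgword k].
  by rewrite eq_word_coef cats0.
move: nb; rewrite lastE ek (eq_word_coef h (t :: w)) head_cat hE fgword_inv.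
case/lastP kE: (fgword k) => [|l x]; last first.
  by rewrite invw_rcons map_rcons last_rcons /= /noback /flip /= eqxx.
by case: h1; rewrite hE; apply: fg_eq1; rewrite fgword_inv kE.
Qed.

End Degree.

(** * Counting the passages through darts outside core(H) *)

Section BadDarts.
Variables (n : nat) (H : set (freegrp 'I_n)) (g : freegrp 'I_n).
Hypothesis H_fg : finitely_generated H.
Let G := wedge_graph H g.
Let L := nb_edges G.
Implicit Types (p q r : gpath G) (w : seq (syllable n)).

Definition noncore_count p := count (fun d => ~~ core_dart d) p.

Lemma syllable_size b r : syllable_loop (inl b : syllable n) r ->
  size r = size (fgword g).
Proof.
move=> [rw [rr rg]]; rewrite -(size_map (@dlab n G)) -/(labeling r) rg.
by case: (b); rewrite // fgword_inv size_invw.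
Qed.

(** The darts counted are pairwise distinct, within each loop by the uniqueness lemmas and between
    the loops because the sides differ; so the two counts share the [2L] darts of the graph. *)
Lemma noncore_loops h b p r : syllable_loop (inr h) p -> syllable_loop (inl b) r ->
  noncore_count p + size (fgword g) <= 2 * L.
Proof.
move=> [pw [lp ph]] rl; have [rw [rr rg]] := rl.
have red_p : reduced p by apply: reduced_of_labeling; rewrite ph fgwordP.
have ur : uniq r.
  by apply: right_loop_uniq rw rr _; rewrite rg; case: (b); [left|right].
rewrite /noncore_count -(syllable_size rl) -size_filter -size_cat; apply: uniq_darts_size.
  exact: wedge_graph_finite.
rewrite cat_uniq (noncore_uniq lp pw red_p) ur andbT /=.
apply/hasPn => d dr; rewrite mem_filter negb_and; apply/orP; right.
apply/negP => dp; have := allP rr d dr.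
by rewrite /= (allP lp d dp).
Qed.

Lemma theta_var_loop w q : 0 < var_count w -> theta_path w q ->
  exists b r, syllable_loop (inl b : syllable n) (r : gpath G).
Proof.
elim: w q => //= -[b|h] w IH q wv [p1 [p2 [_ p1l]]]; first by exists b, p1.
exact: IH.
Qed.

Lemma theta_noncore w q : 0 < var_count w -> theta_path w q ->
  noncore_count q <= var_count w * size (fgword g) +
                     coef_count w * (2 * L - size (fgword g)).
Proof.
move=> wv wq; have [b0 [r0 r0l]] := theta_var_loop wv wq.
elim: w q wq {wv} => [|s w IH] q /=; first by move=> ->.
case=> p1 [p2 [-> p1l /IH]]; rewrite /noncore_count /var_count /coef_count count_cat.
case: s p1l => [b|h] p1l /=.
  have := count_size (fun d => ~~ core_dart d) p1; rewrite (syllable_size p1l).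
  by rewrite add0n mulnDl mul1n -addnA => p1g; apply: leq_add.
have := noncore_loops p1l r0l; rewrite /noncore_count add0n mulnDl mul1n.
move=> p1L IHq; rewrite addnCA; apply: leq_add IHq.
by rewrite leq_subRL; [rewrite addnC | exact: leq_trans (leq_addl _ _) p1L].
Qed.

Lemma noncore_bound w p : is_equation H w -> 0 < var_count w ->
  corresponding_path w p -> noncore_count p <= 4 * L * var_count w.
Proof.
move=> [sw _] wv [pw red_p [q wq /homotopic_reduce]]; rewrite (reduce_id red_p) => qp.
have [b0 [r0 r0l]] := theta_var_loop wv wq.
have := coef_count_le sw; have := theta_noncore wv wq.
have : noncore_count p <= noncore_count q.
  by rewrite -qp; apply: leq_count_subseq (reduce_subseq q).
have : size (fgword g) <= 2 * L.
  rewrite -(syllable_size r0l); apply: uniq_darts_size; first exact: wedge_graph_finite.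
  have [rw [rr rg]] := r0l.
  by apply: right_loop_uniq rw rr _; rewrite rg; case: (b0); [left|right].
have : starts_coef w <= 1 by case: (starts_coef w).
move: (noncore_count p) (noncore_count q) (size (fgword g)) => x y z.
move: (nat_of_bool _) => s.
move: (coef_count w) (var_count w) wv => c v v0 s1 z1 xy yle cv.
(* From [c <= v + 1] and [v >= 1]; then [v z + 2 v (2 L - z) <= 4 L v]. *)
have c2 : c <= 2 * v by lia.
have : c * (2 * L - z) <= 2 * v * (2 * L - z) by rewrite leq_mul2r c2 orbT.
nia.
Qed.

End BadDarts.

(** * Forests of couples *)

(** Translates the [take]/[drop] form of an insertion move at the darts [a] and [b] into the form
    with repeated darts, which cuts undo. *)
Lemma insert_take_drop (S : Type) (P L R m1 m2 : seq S) a b :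
  let s := P ++ a :: L ++ b :: R in let i := size P in let j := (size P + size L).+2 in
  take i s ++ (a :: m1) ++ drop i (take j s) ++ rcons m2 b ++ drop j s =
  P ++ a :: m1 ++ a :: L ++ b :: m2 ++ b :: R.
Proof.
move=> s i j; have sE : s = (P ++ a :: rcons L b) ++ R by rewrite -catA /= cat_rcons.
have jE : j = size (P ++ a :: rcons L b) by rewrite size_cat /= size_rcons !addnS.
rewrite jE {2 3}sE take_size_cat // drop_size_cat // drop_size_cat // take_size_cat //.
by rewrite /= !cat_rcons.
Qed.

Section Trees.
Variable A : eqType.

(* A planar forest, in the first-child/next-sibling representation: [Arc a l b r]
   is the arc pairing [a] with [b] over the forest [l], followed by the forest [r]. *)
Inductive arcs := NoArc | Arc of A & arcs & A & arcs.
Implicit Types (T l r : arcs) (ch : seq (A * A)).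

Fixpoint flat T := if T is Arc a l b r then a :: flat l ++ b :: flat r else [::].

Fixpoint arcs_all (R : rel A) T :=
  if T is Arc a l b r then [&& R a b, arcs_all R l & arcs_all R r] else true.

(** Inner arcs come before the arc over them, as a reduction process requires; [o] is the index of
    the first edge. *)
Fixpoint couples (o : nat) T : seq couple :=
  if T is Arc a l b r then
    couples o.+1 l ++ (o, (o + size (flat l)).+1) :: couples (o + size (flat l)).+2 r
  else [::].

Lemma couples_bounds o T c : c \in couples o T ->
  [&& o <= c.1, c.1 < c.2 & c.2 < o + size (flat T)].
Proof.
elim: T o => //= a l IHl b r IHr o; rewrite size_cat /= mem_cat inE.
by case/or3P=> [/IHl|/eqP->|/IHr] /=; lia.
Qed.

Definition move_couple k (c : couple) : couple := (c.1 + k, c.2 + k).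

Lemma couples_move k o T : couples (o + k) T = map (move_couple k) (couples o T).
Proof.
elim: T o => //= a l IHl b r IHr o; rewrite map_cat /= -IHl -IHr /move_couple /=.
by rewrite !(addnAC o k) !addSn.
Qed.

Lemma entries_cat P Q : entries (P ++ Q) = entries P ++ entries Q.
Proof. by rewrite /entries map_cat flatten_cat. Qed.

Lemma entries_couples o T : perm_eq (entries (couples o T)) (iota o (size (flat T))).
Proof.
elim: T o => //= a l IHl b r IHr o.
have entries_cons c P : entries (c :: P) = [:: c.1, c.2 & entries P] by [].
apply/permP => p; rewrite entries_cat entries_cons count_cat /= size_cat iotaD.
by rewrite count_cat (permP (IHl _)) (permP (IHr _)) /= addSn; lia.
Qed.

(** Collapsibility in the listed order, [Q] being the couples already collapsed. *)
Fixpoint nested_after (Q P : seq couple) := if P is c :: P' then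
  (forall i, c.1 < i < c.2 -> i \in entries Q) /\ nested_after (rcons Q c) P' else True.

Lemma nested_after_cat Q P P' :
  nested_after Q P -> nested_after (Q ++ P) P' -> nested_after Q (P ++ P').
Proof.
elim: P Q => [|c P IH] Q /=; first by rewrite cats0.
by move=> [cQ QP] QP'; split=> //; apply: IH; rewrite // cat_rcons.
Qed.

Lemma nested_afterP Q P k i : nested_after Q P -> k < size P ->
  (nth (0, 0) P k).1 < i < (nth (0, 0) P k).2 -> i \in entries (Q ++ take k P).
Proof.
elim: P Q k => [//|c P IH] Q [|k] /= [cQ QP] kP; first by rewrite cats0; apply: cQ.
by rewrite -cat_rcons; apply: IH.
Qed.

Lemma couples_nested o T Q : nested_after Q (couples o T).
Proof.
elim: T o Q => //= a l IHl b r IHr o Q; apply: nested_after_cat; first exact: IHl.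
split; last exact: IHr.
move=> i /= oi; rewrite entries_cat mem_cat (perm_mem (entries_couples _ _)).
by rewrite mem_iota; apply/orP; right; lia.
Qed.

Lemma size_couples o T : (size (couples o T)).*2 = size (flat T).
Proof.
elim: T o => //= a l IHl b r IHr o.
by rewrite !size_cat /=; have := IHl o.+1; have := IHr (o + size (flat l)).+2; lia.
Qed.

Fixpoint wrap ch T := if ch is ab :: ch' then Arc ab.1 (wrap ch' T) ab.2 NoArc else T.

Lemma flat_wrap ch T : flat (wrap ch T) = unzip1 ch ++ flat T ++ rev (unzip2 ch).
Proof.
elim: ch => [|[a b] ch IH] /=; first by rewrite cats0.
by rewrite IH rev_cons -cats1 -!catA.
Qed.

Lemma arcs_all_wrap R ch T :
  arcs_all R (wrap ch T) = all (fun ab => R ab.1 ab.2) ch && arcs_all R T.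
Proof. by elim: ch => //= ab ch ->; rewrite andbT andbA. Qed.

Lemma couples_wrap ch o T c :
  c \in couples (o + size ch) T -> c \in couples o (wrap ch T).
Proof.
elim: ch o => [|ab ch IH] o /=; first by rewrite addn0.
by rewrite -addSnnS mem_cat => /IH->.
Qed.

Inductive frame := InChild of A & A & arcs | InSibling of A & arcs & A.
Implicit Types (f : frame) (C : seq frame).

Definition fill f T :=
  match f with InChild a b r => Arc a T b r | InSibling a l b => Arc a l b T end.

(* The innermost frame of a context comes first. *)
Definition plug C T := foldl (fun T f => fill f T) T C.

Definition frame_pre f :=
  match f with InChild a b r => [:: a] | InSibling a l b => a :: rcons (flat l) b end.

Definition frame_suf f :=
  match f with InChild a b r => b :: flat r | InSibling a l b => [::] end.

Fixpoint ctx_pre C := if C is f :: C' then ctx_pre C' ++ frame_pre f else [::].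
Fixpoint ctx_suf C := if C is f :: C' then frame_suf f ++ ctx_suf C' else [::].

Definition ctx_offset C := size (ctx_pre C).

Lemma flat_fill f T : flat (fill f T) = frame_pre f ++ flat T ++ frame_suf f.
Proof. by case: f => [a b r|a l b] //=; rewrite cats0 cat_rcons. Qed.

Lemma flat_plug C T : flat (plug C T) = ctx_pre C ++ flat T ++ ctx_suf C.
Proof.
elim: C T => [|f C IH] T /=; first by rewrite cats0.
by rewrite IH flat_fill -!catA.
Qed.

Lemma ctx_offset_cons f C : ctx_offset (f :: C) = ctx_offset C + size (frame_pre f).
Proof. exact: size_cat. Qed.

Lemma arcs_all_plug R C T T' : arcs_all R (plug C T) ->
  arcs_all R T /\ (arcs_all R T' -> arcs_all R (plug C T')).
Proof.
elim: C T T' => [|f C IH] T T' //= RT; have [Rf fT] := IH _ (fill f T') RT.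
by case: f {RT IH} Rf fT => [a b r|a l b] /= /and3P[-> RT Rr] fT; split=> // RT';
  apply: fT; rewrite RT' ?RT ?Rr.
Qed.

Lemma couples_fill f o T c :
  c \in couples (o + size (frame_pre f)) T -> c \in couples o (fill f T).
Proof.
case: f => [a b r|a l b] /=; first by rewrite mem_cat addn1 => ->.
by rewrite mem_cat inE size_rcons !addnS => ->; rewrite !orbT.
Qed.

Lemma couples_plug C o T c :
  c \in couples (o + ctx_offset C) T -> c \in couples o (plug C T).
Proof.
elim: C T => [|f C IH] T /=; first by rewrite addn0.
by rewrite ctx_offset_cons addnA => cT; apply/IH/couples_fill.
Qed.

(* [T'] arises from [T] by inserting two intervals of length [k], at the edge of
   index [e.1] and after the edge of index [e.2]. *)
Definition stretches T T' (e : couple) k :=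
  [/\ size (flat T') = size (flat T) + k.*2, e.1 < e.2 < size (flat T) &
    forall o c, c \in couples o T ->
      shift_couple (move_couple o e) k c \in couples o T'].

Lemma stretches_fill f T T' e k : stretches T T' e k ->
  stretches (fill f T) (fill f T') (move_couple (size (frame_pre f)) e) k.
Proof.
move=> [szT eT TT']; split.
- by rewrite !flat_fill !size_cat szT; lia.
- by rewrite flat_fill !size_cat /=; lia.
have shiftD o c m : shift_couple (move_couple o (move_couple m e)) k c =
    shift_couple (move_couple (o + m) e) k c.
  by rewrite /shift_couple /shift /= !addnA !(addnAC _ m o).
move=> o c; rewrite shiftD; case: f => [a b r|a l b] /=; rewrite !mem_cat !inE.
  rewrite szT; case/or3P=> [cT|/eqP->|].
  - by have := TT' _ _ cT; rewrite addn1 => ->.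
  - by apply/or3P/Or32; rewrite /shift_couple /shift /=; apply/eqP; congr (_, _);
      case: ifP; try case: ifP; lia.
  have -> : (o + (size (flat T) + k.*2)).+2 = (o + size (flat T)).+2 + k.*2 by lia.
  move=> cr; rewrite couples_move; apply/or3P/Or33/mapP; exists c => //.
  have := couples_bounds cr; case: c {cr} => c1 c2 /=.
  rewrite /shift_couple /shift /move_couple /= => c12.
  by congr (_, _); case: ifP; try case: ifP; lia.
have sz : size (a :: rcons (flat l) b) = (size (flat l)).+2 by rewrite /= size_rcons.
case/or3P=> [cl|/eqP->|cT].
- apply/or3P/Or31; have := couples_bounds cl; case: c cl => c1 c2 cl /= c12.
  rewrite (_ : shift_couple _ _ _ = (c1, c2)) // /shift_couple /shift /= size_rcons.
  by congr (_, _); case: ifP; try case: ifP; lia.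
- apply/or3P/Or32; rewrite /shift_couple /shift /= size_rcons.
  by apply/eqP; congr (_, _); case: ifP; try case: ifP; lia.
- by apply/or3P/Or33; have := TT' _ _ cT; rewrite size_rcons !addnS.
Qed.

Lemma stretches_plug C T T' e k : stretches T T' e k ->
  stretches (plug C T) (plug C T') (move_couple (ctx_offset C) e) k.
Proof.
elim: C T T' e => [|f C IH] T T' e TT' /=.
  by rewrite /move_couple !addn0; case: e TT'.
have := IH _ _ _ (stretches_fill f TT'); congr stretches.
by rewrite ctx_offset_cons /move_couple /= !addnA !(addnAC _ (size (frame_pre f))).
Qed.

(** The intervals are inserted just outside the couple, so the old arc becomes the innermost of the
    family; the outer copy and the rest of the chain are new. *)
Lemma stretches_wrap a ch b l r :
  stretches (Arc a l b r) (Arc a (wrap ch (Arc a l b NoArc)) b r)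
            (0, (size (flat l)).+1) (size ch).+1.
Proof.
have szW : size (flat (wrap ch (Arc a l b NoArc))) = (size (flat l)).+2 + (size ch).*2.
  by rewrite flat_wrap !size_cat size_rev !size_map /= size_cat /=; lia.
split=> [||o c].
- by rewrite /= !size_cat szW /=; lia.
- by rewrite /= size_cat /=; lia.
rewrite /= szW !mem_cat !inE; case/or3P=> [cl|/eqP->|cr].
- apply/or3P/Or31/couples_wrap => /=; rewrite mem_cat.
  rewrite (_ : shift_couple _ _ _ = move_couple (size ch).+1 c).
    by rewrite addSn -addnS -addSn couples_move map_f.
  have := couples_bounds cl; case: c {cl} => c1 c2 /=.
  rewrite /shift_couple /shift /move_couple /= => c12.
  by congr (_, _); case: ifP; try case: ifP; lia.
- apply/or3P/Or31/couples_wrap => /=; rewrite mem_cat mem_seq1.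
  apply/orP; right; rewrite /shift_couple /shift /=; apply/eqP.
  by congr (_, _); case: ifP; try case: ifP; lia.
apply/or3P/Or33.
rewrite (_ : (o + _).+2 = (o + size (flat l)).+2 + (size ch).+1.*2); last by lia.
rewrite couples_move; apply/mapP; exists c => //.
have := couples_bounds cr; case: c {cr} => c1 c2 /=.
rewrite /shift_couple /shift /move_couple /= => c12.
by congr (_, _); case: ifP; try case: ifP; lia.
Qed.

(** * Planar forests as maximal reduction processes *)

Section Processes.
Variables (n : nat) (lb : A -> letter 'I_n).

Definition matched : rel A := fun a b => lb b == flip (lb a).

Lemma onth_size_cat (T : Type) (s t : seq T) x : onth (s ++ x :: t) (size s) = Some x.
Proof. by elim: s. Qed.

Lemma couples_matched T s t c : arcs_all matched T -> c \in couples (size s) T ->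
  onth (s ++ map lb (flat T) ++ t) c.2 =
  omap (@flip _) (onth (s ++ map lb (flat T) ++ t) c.1).
Proof.
elim: T s t => //= a l IHl b r IHr s t /and3P[/eqP ab lm rm].
rewrite mem_cat inE; case/or3P=> [cl|/eqP->|cr].
- have := IHl (rcons s (lb a)) (lb b :: map lb (flat r) ++ t) lm.
  by rewrite size_rcons map_cat /= cat_rcons -!catA => ->.
- have KE : (size s + size (flat l)).+1 = size (s ++ lb a :: map lb (flat l)).
    by rewrite size_cat /= size_map addnS.
  rewrite KE onth_size_cat map_cat /= ab -catA.
  by rewrite -cat_cons catA onth_size_cat.
have := IHr (s ++ lb a :: rcons (map lb (flat l)) (lb b)) t rm.
rewrite size_cat /= size_rcons size_map !addnS => /(_ cr).
by rewrite map_cat /= -!catA /= cat_rcons.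
Qed.

Lemma couples_maximal T : arcs_all matched T ->
  maximal_process (map lb (flat T)) (couples 0 T).
Proof.
move=> Tm; have szT : size (map lb (flat T)) = size (flat T) by rewrite size_map.
have eT := entries_couples 0 T; split.
  split.
  - by rewrite (perm_uniq eT) iota_uniq.
  - by move=> c /couples_bounds; rewrite szT add0n => /and3P[_ -> ->].
  - by move=> k i kP; apply: (nested_afterP (Q := [::]) _ kP); apply: couples_nested.
  move=> c cT; have := couples_matched (s := [::]) [::] Tm cT.
  by rewrite cats0.
(* The couples already use every index, so a further one would repeat an edge. *)
move=> c [uc /(_ c) + _ _]; rewrite mem_rcons mem_head => /(_ isT).
rewrite szT => /andP[c12 c2]; move: uc; rewrite -cats1 entries_cat cat_uniq /=.
by rewrite !(perm_mem eT) !mem_iota !add0n c2 /= !orbT /= andbF.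
Qed.

Lemma reduce_flat T : arcs_all matched T -> reduce (map lb (flat T)) = [::].
Proof.
elim: T => //= a l IHl b r IHr /and3P[/eqP ab lm rm].
rewrite -/(reduce _) map_cat /= -reduce_catl IHl // cat0s /= -/(reduce _) IHr // ab.
by rewrite -[RHS](push_flipK (lb a)).
Qed.

Lemma arcs_of_trivial (p : seq A) : reduce (map lb p) = [::] ->
  exists2 T, flat T = p & arcs_all matched T.
Proof.
(* The induction also needs the case of a non-trivial reduction: what precedes the first surviving
   letter is then a trivial stretch, hence a forest. *)
have decomp m q : size q <= m ->
  (reduce (map lb q) = [::] -> exists2 T, flat T = q & arcs_all matched T) /\
  forall y s, reduce (map lb q) = y :: s -> exists T d (r : seq A),
    [/\ q = flat T ++ d :: r, lb d = y, reduce (map lb r) = s & arcs_all matched T].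
  elim: m q => [|m IH] [|d q] //=; try by split=> // _; exists NoArc.
  rewrite ltnS -/(reduce _) => qm; have [_ IHq] := IH q qm.
  case qE: (reduce (map lb q)) IHq => [|y s] /= IHq.
    by split=> // y s [<- <-]; exists NoArc, d, q.
  case: eqP => [yE|_]; last by split=> // _ _ [<- <-]; exists NoArc, d, q.
  have [T [e [r [qE' ey rs Tm]]]] := IHq _ _ erefl.
  have de : matched d e by rewrite /matched ey yE.
  have rm : size r <= m by rewrite qE' size_cat /= in qm; lia.
  have [r0 rc] := IH r rm; split=> [s0|z u su].
    have [|T' rE Tm'] := r0; first by rewrite rs.
    by exists (Arc d T e T'); rewrite /= ?rE ?qE' // de Tm.
  have [|T' [f [t [rE fz tu Tm']]]] := rc z u; first by rewrite rs.
  exists (Arc d T e T'), f, t; rewrite /= de Tm Tm' qE' rE -catA.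
  by split.
by have [] := decomp _ p (leqnn _).
Qed.

End Processes.

End Trees.

(** * Erasing parallel couples *)

Section Erasure.
Variables (A : eqType) (plain : rel A).
Implicit Types (T l r : arcs A) (ch : seq (A * A)).

(* The arcs parallel to the single top arc of [T], listed from the outside. *)
Fixpoint spine T : seq (A * A) :=
  if T is Arc a l b NoArc then if plain a b then (a, b) :: spine l else [::]
  else [::].

Definition plain_chain ch := all (fun ab => plain ab.1 ab.2) ch.

Definition is_leaf T := if T is NoArc then true else false.

(* Keep only the last arc of each colour in a family of parallel arcs; the couples
   are the arcs of the second forest at which something has been removed, in an
   order for which undoing a removal does not interfere with the next ones. *)
Inductive erase : arcs A -> arcs A -> seq couple -> Prop :=
| erase_nil : erase (NoArc A) (NoArc A) [::]
| erase_keep a l b r l' r' cl cr : ~~ (plain a b && ((a, b) \in spine l)) ->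
    erase l l' cl -> erase r r' cr ->
    erase (Arc a l b r) (Arc a l' b r')
      (map (move_couple (size (flat l')).+2) cr ++ map (move_couple 1) cl)
| erase_cut a ch l b r l' r' cl cr : plain a b -> plain_chain ch ->
    (a, b) \notin spine l -> erase l l' cl -> erase r r' cr ->
    erase (Arc a (wrap ch (Arc a l b (NoArc A))) b r) (Arc a l' b r')
      (map (move_couple (size (flat l')).+2) cr ++
        (0, (size (flat l')).+1) :: map (move_couple 1) cl).

(** Take the innermost arc of colour [c] in the family. *)
Lemma spine_last T c : c \in spine T -> exists ch l,
  [/\ T = wrap ch (Arc c.1 l c.2 (NoArc A)), plain_chain ch & c \notin spine l].
Proof.
elim: T => [//|a l IH b [|//] _] /=; case: ifP => // ab; rewrite inE.
have [/IH[ch [l1 [-> ch_pl cl1]]] _|cl] := boolP (c \in spine l).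
  by exists ((a, b) :: ch), l1; rewrite /plain_chain /= ab.
by rewrite orbF => /eqP cE; exists [::], l; rewrite cE in cl *.
Qed.

Lemma erase_exists T : exists T' cs, erase T T' cs.
Proof.
have [m] := ubnP (size (flat T)); elim: m T => // m IH [|a l b r] sz.
  by exists (NoArc A), [::]; apply: erase_nil.
rewrite /= size_cat /= in sz.
have [|r' [cr rr']] := IH r; first by lia.
have [/andP[ab]|ab_l] := boolP (plain a b && ((a, b) \in spine l)); last first.
  have [|l' [cl ll']] := IH l; first by lia.
  by do 2!eexists; apply: erase_keep ll' rr'.
case/spine_last=> ch [l1 [lE ch_pl abl]]; rewrite {}lE in sz *.
have [|l' [cl ll']] := IH l1.
  by rewrite flat_wrap !size_cat /= size_cat in sz; lia.
by do 2!eexists; apply: erase_cut ll' rr'.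
Qed.

Lemma erase_leaf T T' cs : erase T T' cs -> is_leaf T' = is_leaf T.
Proof. by case. Qed.

Lemma spine_wrap ch T : plain_chain ch -> {subset spine T <= spine (wrap ch T)}.
Proof.
elim: ch => [_ c //|[a b] ch IH]; rewrite /plain_chain /= => /andP[-> chp] c cT.
by rewrite inE IH ?orbT.
Qed.

(** An arc keeps a following sibling exactly when it had one, so erasing makes no new arcs parallel;
    after a cut, the surviving arcs come from below the chain. *)
Lemma erase_spine T T' cs : erase T T' cs -> {subset spine T' <= spine T}.
Proof.
elim=> {T T' cs} // [a l b r l' r' cl cr _ _ IHl rr' _|
  a ch l b r l' r' cl cr ab chp _ _ IHl rr' _].
  have := erase_leaf rr'; case: r r' {rr'} => [|? ? ? ?] [|? ? ? ?] //= _ c.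
  by case: ifP => // _; rewrite !inE => /predU1P[->|/IHl ->]; rewrite ?eqxx ?orbT.
have := erase_leaf rr'; case: r r' {rr'} => [|? ? ? ?] [|? ? ? ?] //= _ c.
rewrite ab !inE => /predU1P[->|/IHl cl']; rewrite ?eqxx //; apply/orP; right.
by apply: spine_wrap => //=; rewrite ab inE cl' orbT.
Qed.

Fixpoint uncoloured T := if T is Arc a l b r then
  [&& plain a b ==> ((a, b) \notin spine l), uncoloured l & uncoloured r] else true.

Lemma erase_uncoloured T T' cs : erase T T' cs -> uncoloured T'.
Proof.
elim=> {T T' cs} //=
  [a l b r l' r' cl cr abl ll' -> _ ->|a ch l b r l' r' cl cr _ _ abl ll' -> _ ->];
  rewrite ?andbT; apply/implyP => ab.
  by move: abl; rewrite ab; apply: contra => /(erase_spine ll').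
by apply: contra abl => /(erase_spine ll').
Qed.

Lemma erase_all (R : rel A) T T' cs : erase T T' cs -> arcs_all R T -> arcs_all R T'.
Proof.
elim=> {T T' cs} //=
  [a l b r l' r' cl cr _ _ IHl _ IHr|a ch l b r l' r' cl cr _ _ _ _ IHl _ IHr].
  by case/and3P=> -> /IHl -> /IHr ->.
rewrite arcs_all_wrap /= => /and3P[-> /andP[_ /and3P[_ lR _]] rR].
by rewrite IHl ?IHr.
Qed.

(** The couples coming from [r], from the root and from [l] are kept apart by their index ranges. *)
Lemma erase_couples T T' cs : erase T T' cs ->
  uniq cs /\ {subset cs <= couples 0 T'}.
Proof.
have moveI k : injective (move_couple k).
  by move=> [x1 x2] [y1 y2] [/addIn-> /addIn->].
have sub k X (U : arcs A) : {subset X <= couples 0 U} ->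
    {subset map (move_couple k) X <= couples k U}.
  move=> XU c /mapP[c' /XU c'U ->]; rewrite -[k in couples k U]add0n couples_move.
  by rewrite map_f.
elim=> {T T' cs} [|a l b r l' r' cl cr _ _ [ul /(sub 1%N) sl] _ [ur sr]|
    a ch l b r l' r' cl cr _ _ _ _ [ul /(sub 1%N) sl] _ [ur sr]] //;
  have {sr} := sub (size (flat l')).+2 _ _ sr; move=> sr;
  rewrite [couples _ _]/= add0n.
- split.
    rewrite cat_uniq !map_inj_uniq // ur ul andbT.
    apply/hasPn => c /sl /couples_bounds cl1.
    by apply/negP => /sr /couples_bounds; lia.
  move=> c; rewrite !mem_cat inE => /orP[/sr->|/sl->] //; by rewrite !orbT.
- split.
    rewrite cat_uniq cons_uniq !map_inj_uniq // ur ul !andbT /= negb_or -andbA.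
    apply/and3P; split; first by apply/negP => h; have := couples_bounds (sr _ h).
      apply/hasPn => c /sl /couples_bounds cl1.
      by apply/negP => /sr /couples_bounds; lia.
    by apply/negP => h; have := couples_bounds (sl _ h).
  move=> c; rewrite !mem_cat !inE => /or3P[/sr->|->|/sl->] //; by rewrite !orbT.
Qed.

(** An insertion made at index [k] or later leaves such a couple in place. *)
Definition before k (c : couple) := (c.1 < k) && (c.2 < k).

Lemma before_le k m c : k <= m -> before k c -> before m c.
Proof. by rewrite /before; lia. Qed.

Lemma erase_before T T' cs k : erase T T' cs ->
  all (before (size (flat T') + k)) (map (move_couple k) cs).
Proof.
move=> eT; have [_ sub] := erase_couples eT; apply/allP => _ /mapP[c /sub cT ->].
by have := couples_bounds cT; rewrite add0n /before /=; lia.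
Qed.

Lemma shift_before k s m (cs : seq couple) : all (before k) cs ->
  map (shift_couple (move_couple k (0, s)) m) cs = cs.
Proof.
move=> csk; rewrite -[RHS]map_id; apply/eq_in_map => -[c1 c2] /(allP csk).
rewrite /before /shift_couple /shift /= => c12.
by congr (_, _); case: ifP => //; lia.
Qed.

(** Couples under the arc of the insertion lie between the two inserted intervals, so they move by
    the length of the first only. *)
Lemma shift_inside k s m (cs : seq couple) : all (before s) cs ->
  map (shift_couple (move_couple k (0, s.+1)) m) (map (move_couple k.+1) cs) =
  map (move_couple (m + k).+1) cs.
Proof.
move=> css; rewrite -map_comp; apply/eq_in_map => -[c1 c2] /(allP css).
rewrite /before /shift_couple /shift /move_couple /= => c12.
by congr (_, _); case: ifP => //; try case: ifP => //; lia.
Qed.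

(** * Bounding the plain arcs by the rough ones *)

Section Counting.
Local Open Scope nat_scope.
Variables (K : nat) (R : rel A).
Hypothesis few_colours : forall s : seq (A * A),
  uniq s -> all (fun ab => R ab.1 ab.2) s -> size s <= K.

Fixpoint rough_count T := if T is Arc a l b r then
  ~~ plain a b + rough_count l + rough_count r else 0.

Fixpoint plain_count T := if T is Arc a l b r then
  plain a b + plain_count l + plain_count r else 0.

Lemma size_flat_count T : size (flat T) = (rough_count T + plain_count T).*2.
Proof.
elim: T => //= a l IHl b r IHr; rewrite size_cat /= IHl IHr.
by case: (plain a b); lia.
Qed.

(* Counts the innermost arcs of the maximal families of parallel plain arcs. *)
Fixpoint strip_count T := if T is Arc a l b r then
  (plain a b && nilp (spine l)) + strip_count l + strip_count r else 0.

Fixpoint no_plain_leaf T := if T is Arc a l b r then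
  [&& plain a b ==> ~~ is_leaf l, no_plain_leaf l & no_plain_leaf r] else true.

(* The forest under such an innermost arc branches or is a single rough arc, and
   every leaf is rough. *)
Lemma strip_count_le T : no_plain_leaf T ->
  strip_count T + ~~ is_leaf T + (~~ is_leaf T && nilp (spine T)) <= 2 * rough_count T.
Proof.
elim: T => //= a l IHl b r IHr /and3P[abl /IHl {}IHl /IHr {}IHr].
move: abl IHl IHr; case: (plain a b) => /=; last first.
  by case: r => *; case: (is_leaf l); lia.
move=> ll; rewrite ll /=; case: r => [|? ? ? ?] /=; case: (nilp (spine l)) => /=; lia.
Qed.

Lemma spine_all T : arcs_all R T -> all (fun ab => R ab.1 ab.2) (spine T).
Proof.
elim: T => //= a l IHl b [|//] _ /and3P[ab lR _].
by case: ifP => //= _; rewrite ab IHl.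
Qed.

Lemma spine_uniq T : uncoloured T -> uniq (spine T).
Proof.
elim: T => //= a l IHl b [|//] _ /and3P[abl lu _].
by case: ifP abl => //= _ ->; rewrite IHl.
Qed.

(* The second summand is what the family at the top of [T] may still gain when
   [T] is placed under a parallel plain arc. *)
Lemma plain_count_le T : uncoloured T -> arcs_all R T ->
  plain_count T + (if nilp (spine T) then 0 else K - size (spine T)) <= K * strip_count T.
Proof.
elim: T => // a l IHl b r IHr /= /and3P[abl lu ru] /and3P[ab lR rR].
have {}IHl := IHl lu lR; have {IHr} := IHr ru rR.
have spr : (if r is NoArc then if plain a b then (a, b) :: spine l else [::] else [::]) =
  if is_leaf r && plain a b then (a, b) :: spine l else [::] by case: r {ru rR}.
rewrite spr; case pab: (plain a b) abl => /= abl IHr; last first.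
  rewrite andbF /= addn0 add0n mulnDr.
  by rewrite leq_add // (leq_trans _ IHl, leq_trans _ IHr) ?leq_addr.
(* The colours of the spine stay distinct when [(a, b)] is added, so the bound on the number of
   colours leaves room for one more arc. *)
have szK : size (spine l) < K.
  apply: (few_colours (s := (a, b) :: spine l)); rewrite /= ?abl ?spine_uniq //.
  by rewrite ab spine_all.
move: IHl IHr; case: nilP => [->|/eqP sl0] /=; rewrite !mulnDr.
  by rewrite muln1; case: (is_leaf r) => /=; case: ifP => _; lia.
by rewrite muln0; case: (is_leaf r) => /=; case: ifP => _; lia.
Qed.

(** With [Q] rough arcs there are at most [2Q] families of at most [K] plain arcs each, and every
    arc has two ends. *)
Lemma size_flat_le T : uncoloured T -> arcs_all R T -> no_plain_leaf T ->
  size (flat T) <= 2 * rough_count T * (1 + 2 * K).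
Proof.
move=> Tu TR /strip_count_le sT; have := plain_count_le Tu TR.
have : K * strip_count T <= K * (2 * rough_count T).
  by rewrite leq_mul2l (leq_trans _ sT) ?orbT // -addnA leq_addr.
rewrite size_flat_count; move: (if _ then _ else _) => x.
move: (K * strip_count T) => y yK xy.
nia.
Qed.

End Counting.
End Erasure.

(** * Undoing the erasure one cut at a time *)

Section EraseInsertions.
Variables (D : eqType) (ok : rel D) (core : pred D).
Implicit Types (a b d : D) (p q : seq D) (T l r : arcs D).
Implicit Types (ch : seq (D * D)) (C : seq (frame D)).

Definition core_arc : rel D := fun a b => core a && core b.

(** The context seen from below the chain: the outermost arc is added first, so the innermost frame
    ends up in front. *)
Definition chain_frames ch C :=
  foldl (fun C ab => InChild ab.1 ab.2 (NoArc _) :: C) C ch.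

Lemma plug_wrap ch C T : plug C (wrap ch T) = plug (chain_frames ch C) T.
Proof. by elim: ch C => //= ab ch IH C; rewrite -IH. Qed.

Lemma chain_frames_offset ch C : ctx_offset (chain_frames ch C) = ctx_offset C + size ch.
Proof.
elim: ch C => [|ab ch IH] C /=; first by rewrite addn0.
by rewrite IH ctx_offset_cons addn1 addSnnS.
Qed.

Lemma move_coupleD k m (c : couple) :
  move_couple k (move_couple m c) = move_couple (m + k) c.
Proof. by rewrite /move_couple /= !addnA. Qed.

Lemma map_move_coupleD k m (cs : seq couple) :
  map (move_couple k) (map (move_couple m) cs) = map (move_couple (m + k)) cs.
Proof. by rewrite -map_comp; apply: eq_map => c; apply: move_coupleD. Qed.

Lemma arcs_all_unwrap C a ch l b r :
  arcs_all ok (plug C (Arc a (wrap ch (Arc a l b (NoArc _))) b r)) ->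
  arcs_all ok (plug C (Arc a l b r)).
Proof.
move=> Wm; have [/= /and3P[ab + rm]] := arcs_all_plug (Arc a l b r) Wm.
by rewrite arcs_all_wrap /= => /and4P[_ _ lm _]; apply; rewrite ab rm lm.
Qed.

Lemma root_couple C a l b r :
  move_couple (ctx_offset C) (0, (size (flat l)).+1) \in couples 0 (plug C (Arc a l b r)).
Proof.
apply: couples_plug; rewrite /= mem_cat inE.
by apply/or3P/Or32; rewrite /move_couple /= !add0n addSn (addnC (size _)).
Qed.

Lemma unwrap_couples C a ch l b r c :
  let e := move_couple (ctx_offset C) (0, (size (flat l)).+1) in
  c \in couples 0 (plug C (Arc a l b r)) ->
  shift_couple e (size ch).+1 c \in
    couples 0 (plug C (Arc a (wrap ch (Arc a l b (NoArc _))) b r)).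
Proof.
move=> e cT; have [_ _ strT] := stretches_plug C (stretches_wrap a ch b l r).
by have := strT 0 c cT; rewrite move_coupleD addn0.
Qed.

(** [Phi] stands for properties of the path that survive a cut and [ins] for sequences of insertion
    moves, so that only the bookkeeping of positions remains here. *)
Variable Phi : seq D -> Prop.
Hypothesis Phi_cut : forall p d m q, Phi (p ++ d :: m ++ d :: q) ->
  all core (d :: m) -> Phi (p ++ d :: q).

Variable ins : seq D -> seq couple -> seq couple -> seq D -> Prop.
Hypothesis ins_step : forall C a ch l b r cs sigma,
  let T := plug C (Arc a l b r) in
  let T' := plug C (Arc a (wrap ch (Arc a l b (NoArc _))) b r) in
  let c := move_couple (ctx_offset C) (0, (size (flat l)).+1) in
  core_arc a b -> plain_chain core_arc ch -> arcs_all ok T' ->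
  Phi (flat T') -> Phi (flat T) ->
  ins (flat T') (couples 0 T') (map (shift_couple c (size ch).+1) cs) sigma ->
  ins (flat T) (couples 0 T) (c :: cs) sigma.

(** Removing a chain takes two cuts: from the outer [a] to the inner one, and from the inner [b] to
    the outer one. *)
Lemma Phi_wrap C a ch l b r : core_arc a b -> plain_chain core_arc ch ->
  Phi (flat (plug C (Arc a (wrap ch (Arc a l b (NoArc _))) b r))) ->
  Phi (flat (plug C (Arc a l b r))).
Proof.
move=> /andP[ac bc] chc; rewrite !flat_plug /= flat_wrap.
set m1 := unzip1 ch; set m2 := rev (unzip2 ch).
have m1c : all core (a :: m1).
  by rewrite /= ac all_map; apply: sub_all chc => ab /andP[].
have m2c : all core (b :: m2).
  by rewrite /= bc all_rev all_map; apply: sub_all chc => ab /andP[].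
move=> PhiT.
have {PhiT} : Phi (ctx_pre C ++ a :: flat l ++ b :: m2 ++ b :: flat r ++ ctx_suf C).
  by apply: (Phi_cut (m := m1)) m1c; move: PhiT; rewrite /= -!catA /= -?catA.
rewrite -cat_cons catA => /Phi_cut /(_ m2c).
by rewrite -!catA /= -?catA.
Qed.

(** The erasure treats what is under an arc, then the arc itself, then its right siblings, and the
    moves undo this in reverse order. [rest] holds the moves to be made afterwards; their couples
    lie to the left of the present position, where the current insertions shift nothing. *)
Lemma erase_insertions T T' cs : erase core_arc T T' cs ->
  forall C, arcs_all ok (plug C T) -> Phi (flat (plug C T)) ->
  Phi (flat (plug C T')) /\ forall rest sigma,
    all (before (ctx_offset C)) rest ->
    ins (flat (plug C T)) (couples 0 (plug C T)) rest sigma ->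
    ins (flat (plug C T')) (couples 0 (plug C T'))
      (map (move_couple (ctx_offset C)) cs ++ rest) sigma.
Proof.
elim=> {T T' cs} [|a l b r l' r' cl cr _ ll' IHl rr' IHr|
  a ch l b r l' r' cl cr ab chp abl ll' IHl rr' IHr] C Tm PhiT //.
- have [PhiL insL] := IHl (InChild a b r :: C) Tm PhiT.
  have Lm : arcs_all ok (plug C (Arc a l' b r)).
    have [/= /and3P[ab lm rm]] := arcs_all_plug (Arc a l' b r) Tm.
    by apply; rewrite /= ab rm (erase_all ll' lm).
  have [PhiR insR] := IHr (InSibling a l' b :: C) Lm PhiL.
  split=> // rest sigma restC insT.
  rewrite map_cat -catA !map_move_coupleD.
  have offR : ctx_offset (InSibling a l' b :: C) = (size (flat l')).+2 + ctx_offset C.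
    by rewrite ctx_offset_cons /= size_rcons addnC.
  have offL : ctx_offset (InChild a b r :: C) = 1 + ctx_offset C.
    by rewrite ctx_offset_cons /= addnC.
  rewrite -offR -offL; apply: insR.
    rewrite all_cat; apply/andP; split; last first.
      by apply: sub_all restC => c; apply: before_le; rewrite offR leq_addl.
    apply: sub_all (erase_before _ ll') => c; apply: before_le.
    by rewrite offR offL addnA addn1 leq_add2r.
  apply: insL => //; apply: sub_all restC => c; apply: before_le.
  by rewrite offL leq_addl.
(* First [l] is erased with the chain still around it; the chain is removed afterwards. *)
pose C1 := chain_frames ch (InChild a b r :: C).
have C1E X : plug (InChild a b (NoArc _) :: C1) X =
    plug C (Arc a (wrap ch (Arc a X b (NoArc _))) b r).
  by rewrite /= -plug_wrap.
rewrite -C1E in Tm PhiT.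
have [PhiL insL] := IHl (InChild a b (NoArc _) :: C1) Tm PhiT.
rewrite !C1E in Tm PhiT PhiL insL.
have Wm : arcs_all ok (plug C (Arc a (wrap ch (Arc a l' b (NoArc _))) b r)).
  have [+ ] := arcs_all_plug (Arc a (wrap ch (Arc a l' b (NoArc _))) b r) Tm.
  rewrite /= !arcs_all_wrap /= => /and3P[-> /andP[-> /and3P[_ lm _]] ->].
  by apply; rewrite (erase_all ll' lm).
have Lm := arcs_all_unwrap Wm.
have PhiL' := Phi_wrap ab chp PhiL.
have [PhiR insR] := IHr (InSibling a l' b :: C) Lm PhiL'.
split=> // rest sigma restC insT.
rewrite map_cat -catA !map_move_coupleD.
have offR : ctx_offset (InSibling a l' b :: C) = (size (flat l')).+2 + ctx_offset C.
  by rewrite ctx_offset_cons /= size_rcons addnC.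
rewrite -offR; apply: insR.
  rewrite [map _ (_ :: _)]/= map_move_coupleD cat_cons /= all_cat; apply/and3P; split.
  - by rewrite offR /before /=; lia.
  - apply: sub_all (erase_before _ ll') => c; apply: before_le.
    by rewrite offR addnA addn1 leq_add2r.
  - by apply: sub_all restC => c; apply: before_le; rewrite offR leq_addl.
(* The move at the root restores the chain and pushes the couples of [cl] to the right by
   [(size ch).+1]. *)
rewrite /= map_move_coupleD; apply: (ins_step (ch := ch)) => //.
have offW : ctx_offset (InChild a b (NoArc _) :: C1) = ((size ch).+1 + ctx_offset C).+1.
  by rewrite ctx_offset_cons chain_frames_offset ctx_offset_cons /= !addn1 addSn addnC.
rewrite map_cat (shift_before _ _ restC) add1n shift_inside; last first.
  by have := erase_before 0 ll'; rewrite addn0 (eq_map (_ : move_couple 0 =1 id)) ?map_id;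
    [|case=> ? ?; rewrite /move_couple /= !addn0].
rewrite -offW; apply: insL => //.
apply: sub_all restC => c; apply: before_le.
by rewrite offW -addSn leq_addl.
Qed.

End EraseInsertions.

(** * Insertion moves *)

Section ParallelLoops.
Variables (n : nat) (X : lgraph n) (S : pred (edge X)) (core : pred (dart X)).
Hypothesis immS : immersed_on S.
Hypothesis core_S : forall d, core d -> S d.1.

Let ok : rel (dart X) := matched (@dlab n X).

Lemma labeling_rev_chain (ch : seq (dart X * dart X)) : all (fun ab => ok ab.1 ab.2) ch ->
  labeling (rev (unzip2 ch)) = invw (labeling (unzip1 ch)).
Proof.
move=> chm; rewrite /labeling /invw map_rev -!map_comp; congr rev.
by apply/eq_in_map => ab /(allP chm)/eqP.
Qed.

(** The insertion word is the label of the stretch from the outer [a] up to the inner one. Since the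
    inner [a] follows it in a reduced path and the labeling is locally injective there, the word is
    cyclically reduced; the matched stretch on the other side spells its inverse. *)
Lemma parallel_loops C a ch l b r v w :
  let T := plug C (Arc a l b r) in
  let T' := plug C (Arc a (wrap ch (Arc a l b (NoArc _))) b r) in
  let c := move_couple (ctx_offset C) (0, (size (flat l)).+1) in
  let tau1 := a :: unzip1 ch in let tau2 := rcons (rev (unzip2 ch)) b in
  core_arc core a b -> plain_chain (core_arc core) ch -> arcs_all ok T' ->
  walk v (flat T') w -> reduced (flat T') ->
  exists u : freegrp 'I_n,
    [/\ labeling tau1 = fgword u, labeling tau2 = fgword u^-1, cyc_reduced (fgword u),
       walk (dsrc a) tau1 (dsrc a) & walk (dtgt b) tau2 (dtgt b)] /\
    [/\ all core tau1, all core tau2,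
       onth (flat T) c.1 = Some a, onth (flat T) c.2 = Some b &
       flat T' = take c.1 (flat T) ++ tau1 ++ drop c.1 (take c.2.+1 (flat T))
                 ++ tau2 ++ drop c.2.+1 (flat T)].
Proof.
move=> T T' c tau1 tau2 /andP[ac bc] chc T'm T'w red_T'.
have tau1c : all core tau1.
  by rewrite /= ac all_map; apply: sub_all chc => ab /andP[].
have tau2c : all core tau2.
  by rewrite all_rcons bc all_rev all_map; apply: sub_all chc => ab /andP[].
have tau2l : labeling tau2 = invw (labeling tau1).
  have [/= /and3P[/eqP ab + _] _] := arcs_all_plug (Arc a l b r) T'm.
  rewrite arcs_all_wrap => /andP[/labeling_rev_chain chl _].
  by rewrite invw_cons -chl /labeling map_rcons ab.
pose P := ctx_pre C; pose R := flat r ++ ctx_suf C.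
have TE : flat T = P ++ a :: flat l ++ b :: R by rewrite flat_plug /= -catA.
have T'a : flat T' =
    P ++ a :: unzip1 ch ++ a :: (flat l ++ b :: rev (unzip2 ch) ++ b :: R).
  by rewrite flat_plug /= flat_wrap /= -!catA /= -!catA.
have T'b : flat T' =
    (P ++ a :: unzip1 ch ++ a :: flat l) ++ b :: rev (unzip2 ch) ++ b :: R.
  by rewrite T'a -!catA /= -!catA.
have aw : walk (dsrc a) tau1 (dsrc a) by rewrite T'a in T'w; apply: walk_cut_loop T'w.
have bw : walk (dtgt b) tau2 (dtgt b).
  rewrite T'b in T'w; have /andP[_ m2w] := walk_cut_loop T'w; rewrite /tau2 -cats1.
  by apply/walk_catP; exists (dsrc b) => //=; rewrite !eqxx.
have a_cyc : reduced (labeling (rcons tau1 a)).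
  apply: (immersed_reduced immS (v := dsrc a) (w := dtgt a)).
  - apply/allP => d; rewrite mem_rcons inE.
    by case/predU1P=> [->|/(allP tau1c)]; apply: core_S.
  - by rewrite -cats1; apply/walk_catP; exists (dsrc a) => //=; rewrite !eqxx.
  - by rewrite T'a in red_T'; apply: (sorted_cut_loop red_T').
have red_u : reduced (labeling tau1).
  by move: a_cyc; rewrite -cats1 labeling_cat => /reduced_catl.
exists (FreeGrp red_u); split; split=> //.
- by move: a_cyc; rewrite /labeling map_rcons.
- by rewrite TE onth_size_cat.
- rewrite TE -cat_cons catA (_ : c.2 = size (P ++ a :: flat l)) ?onth_size_cat //.
  by rewrite size_cat addnC.
rewrite TE T'a (_ : c.1 = size P) // (_ : c.2.+1 = (size P + size (flat l)).+2).
  by rewrite insert_take_drop.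
by rewrite /= addSn addnC.
Qed.

End ParallelLoops.

Section Insertion.
Variables (n : nat) (H : set (freegrp 'I_n)) (g : freegrp 'I_n).
Let G := wedge_graph H g.
Let core : pred (dart G) := @core_dart n H g.
Let ok : rel (dart G) := matched (@dlab n G).

Lemma core_dartP (d : dart G) : reflect (in_core d.1) (core d).
Proof. exact: asboolP. Qed.

Lemma core_dart_left (d : dart G) : core d -> @left_edge n H g d.1.
Proof. by move/core_dartP; case: d => [[e|e] b]. Qed.

Lemma core_loop_of_all v u (p : gpath G) : all core p -> walk v p v ->
  labeling p = fgword u -> core_loop v u p.
Proof.
by move=> pc pv pu; split=> // d dp; apply/core_dartP; apply: (allP pc).
Qed.

Lemma insertions_step C a ch l b r cs sigma :
  let T := plug C (Arc a l b r) in
  let T' := plug C (Arc a (wrap ch (Arc a l b (NoArc _))) b r) in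
  let c := move_couple (ctx_offset C) (0, (size (flat l)).+1) in
  core_arc core a b -> plain_chain (core_arc core) ch -> arcs_all ok T' ->
  walk (base G) (flat T') (base G) -> reduced (flat T') ->
  walk (base G) (flat T) (base G) -> reduced (flat T) ->
  insertions (flat T') (couples 0 T') (map (shift_couple c (size ch).+1) cs) sigma ->
  insertions (flat T) (couples 0 T) (c :: cs) sigma.
Proof.
move=> T T' c abc chc T'm T'w red_T' Tw red_T insT'.
have [u [[tau1u tau2u cyc aw bw] [tau1c tau2c c1 c2 T'E]]] :=
  parallel_loops (@left_immersed n H g) core_dart_left abc chc T'm T'w red_T'.
have szu : size (fgword u) = (size ch).+1 by rewrite -tau1u /= !size_map.
have [ac bc] := andP abc.
have Tm := arcs_all_unwrap T'm.
rewrite -szu in insT'; apply: insertions_cons insT'.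
- by split=> //; apply/null_homotopicP; apply: reduce_flat.
- exact: couples_maximal.
- exact: root_couple.
- exists a, b, (a :: unzip1 ch), (rcons (rev (unzip2 ch)) b).
  split; first by split=> //; apply/core_dartP.
  split=> //; try exact: core_loop_of_all.
  split=> //.
  + by exists (a :: unzip1 ch); apply: core_loop_of_all.
  (* The second inserted loop spells [u^-1], so traversing it backwards gives the loop of [u] at the
     same vertex. *)
  + exists (invw (rcons (rev (unzip2 ch)) b)); apply: core_loop_of_all.
    * by rewrite /invw all_rev all_map.
    * exact: walk_invw.
    * by rewrite labeling_invw tau2u invwK.
  + by rewrite -tau1u.
- exact: couples_maximal.
- by move=> c' c'T; rewrite szu; apply: unwrap_couples.
Qed.

End Insertion.

(** * The length bound *)

Section ArcsInGraph.
Variables (n : nat) (X : lgraph n) (S : pred (edge X)) (core : pred (dart X)).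
Hypothesis immS : immersed_on S.
Hypothesis core_S : forall d, core d -> S d.1.

Let ok : rel (dart X) := matched (@dlab n X).

(** The two darts of an innermost arc are consecutive with inverse labels; if both were plain, local
    injectivity would make them a backtrack in a reduced path. *)
Lemma graph_no_plain_leaf (T : arcs (dart X)) v w : arcs_all ok T ->
  walk v (flat T) w -> reduced (flat T) -> no_plain_leaf (core_arc core) T.
Proof.
elim: T v w => //= a l IHl b r IHr v w /and3P[ab lm rm] /andP[_ /walk_catP[u lw]].
move=> /= /andP[/eqP bu rw] red_T.
have red_ab := @path_sorted _ _ _ _ red_T.
have lr : no_plain_leaf (core_arc core) l.
  by apply: IHl lw _ => //; apply: reduced_catl red_ab.
have rr : no_plain_leaf (core_arc core) r.
  by apply: IHr rw _ => //; apply: path_sorted (reduced_catr red_ab).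
rewrite lr rr !andbT; apply/implyP => /andP[ac bc].
case: l {lr IHl lm red_ab} lw red_T => //= /eqP au /andP[nab _].
have := immersed_noback immS (core_S ac) (core_S bc) _ nab.
rewrite au bu => /(_ erefl); have /eqP -> := ab.
by rewrite /noback eqxx.
Qed.

(** Matching forces the orientation of the second dart, so a colour is determined by one of [2L]
    darts and one of [L] edges. *)
Lemma few_matched_pairs (s : seq (dart X * dart X)) : finite_set [set: edge X] ->
  uniq s -> all (fun ab => ok ab.1 ab.2) s -> size s <= (2 * nb_edges X ^ 2)%N.
Proof.
move=> Xfin us sm; rewrite -(size_map (fun ab => (ab.1, ab.2.1))).
apply: uniq_colours_size => //; rewrite map_inj_in_uniq // => -[a b] [a' b'].
move=> /(allP sm)/eqP /= ab /(allP sm)/eqP /= a'b' [aa' bb']; subst a'.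
congr (_, _); case: b b' ab a'b' bb' => [e i] [e' i'] /= [_ ->] [_ ->] /= ->.
by [].
Qed.

Lemma rough_count_le (T : arcs (dart X)) :
  rough_count (core_arc core) T <= count (fun d => ~~ core d) (flat T).
Proof.
elim: T => //= a l IHl b r IHr; rewrite count_cat /=.
move: IHl IHr; rewrite /core_arc; case: (core a); case: (core b) => /=; lia.
Qed.

End ArcsInGraph.

Lemma eq_word_neq0 n (H : set (freegrp 'I_n)) w :
  is_equation H w -> w <> [::] -> eq_word w != [::].
Proof.
case: w => [|[b|h] w] [_ cof] // _; have [_ h1] := cof h (mem_head _ _).
rewrite eq_word_coef; case hE: (fgword h) => [|x l] //.
by case: h1; apply: fg_eq1.
Qed.

(** The bound obtained is [8 L d + 32 L^3 d], linear in [d]; its terms are dominated by [16 L^3 d]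
    and [32 L^4 d^2] respectively. *)
Lemma path_length_bound L d N Q :
  Q <= (4 * L * d)%N -> N <= (2 * Q * (1 + 2 * (2 * L ^ 2)))%N ->
  (N <= 32 * L ^ 4 * d ^ 2 + 16 * L ^ 3 * d)%N.
Proof.
move=> QL /leq_trans; apply.
apply: (@leq_trans (2 * (4 * L * d) * (1 + 2 * (2 * L ^ 2)))%N).
  by rewrite leq_mul2r leq_mul2l QL orbT.
case: L {Q QL} => [|L]; first by [].
case: d => [|d]; first by rewrite !muln0.
set l := L.+1; set e := d.+1.
have le1 : 0 < l by []. have e1 : 0 < e by [].
have h1 : l * e <= l ^ 3 * e by rewrite leq_mul2r -{1}(expn1 l) leq_pexp2l ?orbT.
have h2 : l ^ 3 * e <= l ^ 4 * e ^ 2.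
  by apply: leq_mul; [rewrite leq_pexp2l | rewrite -{1}(expn1 e) leq_pexp2l].
nia.
Qed.

(* Assembling the equation, the bound and the moves *)
Local Close Scope group_scope.
Local Close Scope classical_set_scope.

Theorem theorem5p12 (n : nat) (H : set (freegrp 'I_n)) (g : freegrp 'I_n)
    (d : nat) (w : seq (syllable n)) (sigma : gpath (wedge_graph H g)) :
  finitely_generated H ->
  g <> 1%g ->
  depends_on g H ->
  1 <= d ->
  eq_ideal H g w -> w <> [::] -> cyc_reduced_equation w -> degree w = d ->
  corresponding_path w sigma ->
  let L := nb_edges (wedge_graph H g) in
  exists (w' : seq (syllable n)) (sigma' : gpath (wedge_graph H g))
         (P : seq couple),
    [/\ eq_ideal H g w', cyc_reduced_equation w', degree w' = d,
        corresponding_path w' sigma' & maximal_process (labeling sigma') P] /\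
    size sigma' <= 32 * L ^ 4 * d ^ 2 + 16 * L ^ 3 * d /\
    exists cs : seq couple,
      [/\ uniq cs, {subset cs <= P}, (size cs).*2 <= size sigma'
        & insertions sigma' P cs sigma].
Proof.
move=> Hfg g1 _ d1 [weq wphi] w0 wcyc wd wsigma L.
have H_grp : is_subgroup H by case: Hfg => S ->; apply: generated_subgroup.
rewrite (degree_var_count weq wcyc) in wd.
have wB := corresponding_block g1 weq wsigma.
have trivial_sigma : reduce (labeling sigma) = [::].
  by have := congr1 (@fgword _) (block_phi wB); rewrite wphi.
have [T Tsigma Tm] := arcs_of_trivial trivial_sigma.
pose core : pred (dart (wedge_graph H g)) := @core_dart n H g.
have [T' [cs TT']] := erase_exists (core_arc core) T.
(* Fixing the number of letters [x] and both end letters carries over the degree and cyclic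
   reducedness; the count of darts outside core(H) is bounded for [sigma] and never grows under a
   cut. *)
pose Phi (p : gpath (wedge_graph H g)) := noncore_count p <= 4 * L * d /\
  exists w', [/\ block_path w' p, var_count w' = d &
    forall x0, head x0 (eq_word w') = head x0 (eq_word w) /\
               last x0 (eq_word w') = last x0 (eq_word w)].
have Phi_cut p a m q : Phi (p ++ a :: m ++ a :: q) -> all core (a :: m) ->
    Phi (p ++ a :: q).
  move=> [ncL [w1 [w1B w1d w1w]]] am.
  have lam : edges_in (@left_edge n H g) (a :: m).
    by apply: sub_all am; apply: core_dart_left.
  have [w2 [w2B w2d _ _ w2w]] := block_cut H_grp w1B lam.
  split; last first.
    exists w2; split; rewrite ?w2d //.
    by move=> x0; rewrite !(w2w _).1 !(w2w _).2; apply: w1w.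
  apply: leq_trans ncL; rewrite /noncore_count !count_cat leq_add2l -cat_cons count_cat.
  exact: leq_addl.
have Phi_sigma : Phi (flat (plug [::] T)).
  rewrite /= Tsigma; split; last by exists w.
  by rewrite -wd; apply: noncore_bound => //; rewrite wd.
have plugTm : arcs_all (matched (@dlab n (wedge_graph H g))) (plug [::] T) by [].
have [|[ncL [w' [w'B w'd w'w]]] ins] := erase_insertions (ins := @insertions n H g)
    Phi_cut _ TT' plugTm Phi_sigma.
  move=> C a ch l b r cs' sigma' T1 T2 c abc chc T2m.
  move=> [_ [w2 [w2B _ _]]] [_ [w1 [w1B _ _]]].
  by apply: insertions_step => //; [exact: block_walk w2B | exact: block_reduced w2B
    | exact: block_walk w1B | exact: block_reduced w1B].
rewrite /= in ncL w'B ins.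
have T'm := erase_all TT' Tm.
have w'eq := block_equation w'B.
have w'cyc : cyc_reduced_equation w'.
  have w'0 : w' <> [::] by move=> w'0; move: d1; rewrite -w'd w'0.
  pose x0 : letter (option 'I_n) := (None, true).
  rewrite /cyc_reduced_equation (cyc_reducedE x0 (eq_word_neq0 w'eq w'0)).
  (* Words of equations are reduced, and the two ends are those of [w], so the cyclic junction is
     the same. *)
  rewrite (eq_word_reduced w'eq) (w'w x0).1 (w'w x0).2.
  move: wcyc; rewrite /cyc_reduced_equation.
  by rewrite (cyc_reducedE x0 (eq_word_neq0 weq w0)) => /andP[].
have T'trivial : reduce (labeling (flat T')) = [::] by apply: reduce_flat.
have [ucs scs] := erase_couples TT'.
exists w', (flat T'), (couples 0 T'); split; last split.
- split=> //.
  + split=> //; rewrite -(block_phi w'B).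
    by apply: val_inj; rewrite /= T'trivial.
  + by rewrite (degree_var_count w'eq w'cyc).
  + exact: block_corresponding.
  + exact: couples_maximal.
(* Here [Q] counts the couples that are not plain, and the number of colours is at most [2L^2]. *)
- apply: path_length_bound (leq_trans (rough_count_le core T') ncL) _.
  apply: size_flat_le (erase_uncoloured TT') (T'm) _.
    by move=> s us sm; apply: few_matched_pairs => //; apply: wedge_graph_finite.
  apply: graph_no_plain_leaf (block_walk w'B) (block_reduced w'B) => //.
    exact: left_immersed.
  exact: core_dart_left.
- exists cs; split=> //.
  (* The process has exactly half as many couples as the path has edges, and [cs] selects distinct
     ones. *)
  + by rewrite -(size_couples 0 T') leq_double; apply: uniq_leq_size.
  (* The forest is that of the whole path: the context is empty and no move remains after those of
     [cs]. *)
  have := ins [::] sigma isT; rewrite cats0 Tsigma.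
  rewrite (eq_map (_ : move_couple 0 =1 id)) ?map_id.
    by apply; apply: insertions_nil.
  by case=> ? ?; rewrite /move_couple /= !addn0.
Qed.
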